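(* Let $d\in\{7,11,19\}$. The mirror of every complex reflection in $\Gamma_d$ is in the $\Gamma_d$-orbit of the mirror polar to exactly one of the vectors $w_1=(0,1,0)$, $w_2=(1,0,1)$. The subgroup of $\Gamma_d$ fixing pointwise the mirror polar to each of $w_1,w_2$ is cyclic of order $2$.
   Context: On $\mathbb{C}^3$ let $\langle v,w\rangle=w^*Jv$ with $J=\begin{pmatrix}0&0&1\\0&1&0\\1&0&0\end{pmatrix}$, $U(J)=\{A\in GL_3(\mathbb{C}):A^*JA=J\}$, and let $\Gamma_d=PU(J,\mathcal{O}_d)$ be the image in $PU(J)$ of $U(J)\cap GL_3(\mathcal{O}_d)$, with $\mathcal{O}_d$ the ring of integers of $\mathbb{Q}(i\sqrt d)$. It acts on the complex hyperbolic plane $\mathbf{H}^2_{\mathbb{C}}=\{\mathbb{C}v:\langle v,v\rangle<0\}$. For $w$ with $\langle w,w\rangle>0$, the mirror polar to $w$ is $\{\mathbb{C}v\in\mathbf{H}^2_{\mathbb{C}}:\langle v,w\rangle=0\}$; a complex reflection is a nontrivial finite-order element fixing pointwise such a mirror. *)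

(* Defs.v *)
From HB Require Import structures.
From mathcomp Require Import all_boot all_order all_algebra.
From mathcomp Require Import generic_quotient complex.
From mathcomp Require Import boolp classical_sets functions cardinality reals.

Set Implicit Arguments.
Unset Strict Implicit.
Unset Printing Implicit Defensive.

Import Order.TTheory GRing.Theory Num.Theory.

Local Open Scope classical_set_scope.
Local Open Scope quotient_scope.
Local Open Scope ring_scope.

Definition ctrmx (R : realType) (m n : nat) (A : 'M[R[i]]_(m, n)) :
  'M[R[i]]_(n, m) := map_mx Num.conj A^T.

Definition J (R : realType) : 'M[R[i]]_3 :=
  \matrix_(i < 3, j < 3) (i + j == 2)%N%:R.

Definition herm (R : realType) (v w : 'cV[R[i]]_3) : R[i] :=
  (ctrmx w *m J R *m v) ord0 ord0.

Lemma ctrmxM (R : realType) (m n p : nat) (A : 'M[R[i]]_(m, n))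
  (B : 'M[R[i]]_(n, p)) : ctrmx (A *m B) = ctrmx B *m ctrmx A.
Proof. by rewrite /ctrmx trmx_mul map_mxM. Qed.

Lemma ctrmx1 (R : realType) (n : nat) : ctrmx (1%:M : 'M[R[i]]_n) = 1%:M.
Proof. by rewrite /ctrmx trmx1 map_mx1. Qed.

Section UnitaryGroup.
Variable R : realType.
Local Notation C := R[i].

Definition unitaryJ (A : 'M[C]_3) : bool :=
  (A \in unitmx) && (ctrmx A *m J R *m A == J R).

Record UJ : predArgType := MkUJ {UJval :> 'M[C]_3; UJvalP : unitaryJ UJval}.
HB.instance Definition _ := [isSub for UJval].
HB.instance Definition _ := [Choice of UJ by <:].

Lemma unitaryJ1 : unitaryJ 1%:M.
Proof. by rewrite /unitaryJ unitmx1 ctrmx1 mul1mx mulmx1 /=. Qed.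

Lemma unitaryJM (A B : 'M[C]_3) :
  unitaryJ A -> unitaryJ B -> unitaryJ (A *m B).
Proof.
move=> /andP[uA /eqP hA] /andP[uB /eqP hB].
rewrite /unitaryJ unitmx_mul uA uB /= ctrmxM.
by rewrite -!mulmxA (mulmxA (J R)) (mulmxA (ctrmx A)) (mulmxA (ctrmx A)) hA
  mulmxA hB.
Qed.

Lemma unitaryJV (A : 'M[C]_3) : unitaryJ A -> unitaryJ (invmx A).
Proof.
move=> /andP[uA /eqP hA]; rewrite /unitaryJ unitmx_inv uA /=.
rewrite -{1}hA !mulmxA -ctrmxM mulmxV // ctrmx1 mul1mx.
by rewrite -mulmxA mulmxV // mulmx1.
Qed.

Definition UJ_one : UJ := MkUJ unitaryJ1.
Definition UJ_mul (A B : UJ) : UJ := MkUJ (unitaryJM (UJvalP A) (UJvalP B)).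
Definition UJ_inv (A : UJ) : UJ := MkUJ (unitaryJV (UJvalP A)).

Lemma UJ_unit (A : UJ) : UJval A \in unitmx.
Proof. by case/andP: (UJvalP A). Qed.

Lemma UJ_mulA : associative UJ_mul.
Proof. by move=> A B D; apply: val_inj; rewrite /= mulmxA. Qed.
Lemma UJ_mul1 : left_id UJ_one UJ_mul.
Proof. by move=> A; apply: val_inj; rewrite /= mul1mx. Qed.
Lemma UJ_mulr1 : right_id UJ_one UJ_mul.
Proof. by move=> A; apply: val_inj; rewrite /= mulmx1. Qed.
Lemma UJ_mulV : left_inverse UJ_one UJ_inv UJ_mul.
Proof. by move=> A; apply: val_inj; rewrite /= mulVmx // UJ_unit. Qed.
Lemma UJ_mulrV : right_inverse UJ_one UJ_inv UJ_mul.
Proof. by move=> A; apply: val_inj; rewrite /= mulmxV // UJ_unit. Qed.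

HB.instance Definition _ :=
  isGroup.Build UJ UJ_mulA UJ_mul1 UJ_mulr1 UJ_mulV UJ_mulrV.

(* PU(J) is the quotient of U(J) by its scalar matrices. *)
Definition projeq (A B : UJ) : bool := `[< exists c : C, UJval A = c *: UJval B >].

Lemma projeq_refl : reflexive projeq.
Proof. by move=> A; apply/asboolP; exists 1; rewrite scale1r. Qed.

Lemma projeq_neq0 (A B : UJ) (c : C) : UJval A = c *: UJval B -> c != 0.
Proof.
move=> h; apply/eqP => c0; have := UJ_unit A.
by rewrite h c0 scale0r unitmxE det0 unitr0.
Qed.

Lemma projeq_imp (A B : UJ) : projeq A B -> projeq B A.
Proof.
move=> /asboolP[c h]; apply/asboolP; exists c^-1.
by rewrite h scalerA mulVf ?scale1r // (projeq_neq0 h).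
Qed.

Lemma projeq_sym : symmetric projeq.
Proof. by move=> A B; apply/idP/idP; apply: projeq_imp. Qed.

Lemma projeq_trans : transitive projeq.
Proof.
move=> B A D /asboolP[c h] /asboolP[e k]; apply/asboolP; exists (c * e).
by rewrite h k scalerA.
Qed.

Canonical projeq_equiv := EquivRel projeq projeq_refl projeq_sym projeq_trans.

Definition PU : Type := {eq_quot projeq}.
HB.instance Definition _ := Choice.on PU.
HB.instance Definition _ := EqQuotient.on PU.

Lemma PU_eqP (A B : UJ) :
  reflect (exists c : C, UJval A = c *: UJval B) (\pi_PU A == \pi_PU B).
Proof. by rewrite eqmodE; apply: asboolP. Qed.

Definition PU_one : PU := \pi_PU (1%g : UJ).
Definition PU_mul (g h : PU) : PU := \pi_PU ((repr g * repr h)%g : UJ).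
Definition PU_inv (g : PU) : PU := \pi_PU (((repr g)^-1)%g : UJ).

Lemma PU_repr (A : UJ) : exists c : C, UJval (repr (\pi_PU A)) = c *: UJval A.
Proof. by apply/PU_eqP; rewrite reprK. Qed.

Lemma PU_piM (A B : UJ) : PU_mul (\pi_PU A) (\pi_PU B) = \pi_PU ((A * B)%g : UJ).
Proof.
have [c hc] := PU_repr A; have [e he] := PU_repr B.
apply/eqP/PU_eqP; exists (c * e).
rewrite /= hc he.
by rewrite -scalemxAl -scalemxAr scalerA.
Qed.

Lemma PU_piV (A : UJ) : PU_inv (\pi_PU A) = \pi_PU ((A^-1)%g : UJ).
Proof.
have [c hc] := PU_repr A; apply/eqP/PU_eqP; exists c^-1.
rewrite /= hc invmxZ //.
by rewrite -hc UJ_unit.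
Qed.

Lemma PU_ind (P : PU -> Prop) : (forall A : UJ, P (\pi_PU A)) -> forall g, P g.
Proof. by move=> hP g; rewrite -[g]reprK. Qed.

Lemma PU_mulA : associative PU_mul.
Proof.
elim/PU_ind=> A; elim/PU_ind=> B; elim/PU_ind=> D.
rewrite (PU_piM B D) (PU_piM A (B * D)%g) (PU_piM A B) (PU_piM (A * B)%g D).
by rewrite mulgA.
Qed.
Lemma PU_mul1 : left_id PU_one PU_mul.
Proof. by elim/PU_ind=> A; rewrite (PU_piM 1%g A) mul1g. Qed.
Lemma PU_mulr1 : right_id PU_one PU_mul.
Proof. by elim/PU_ind=> A; rewrite (PU_piM A 1%g) mulg1. Qed.
Lemma PU_mulV : left_inverse PU_one PU_inv PU_mul.
Proof.
by elim/PU_ind=> A; rewrite (PU_piV A) (PU_piM (A^-1)%g A) mulVg.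
Qed.
Lemma PU_mulrV : right_inverse PU_one PU_inv PU_mul.
Proof.
by elim/PU_ind=> A; rewrite (PU_piV A) (PU_piM A (A^-1)%g) mulgV.
Qed.

HB.instance Definition _ :=
  isGroup.Build PU PU_mulA PU_mul1 PU_mulr1 PU_mulV PU_mulrV.

(* A point of the projective plane is a line in C^3, i.e. a subspace; [act]
   does not depend on the representative, by [act_pi]. *)
Definition act (g : PU) (L : {vspace 'cV[C]_3}) : {vspace 'cV[C]_3} :=
  (linfun (mulmx (UJval (repr g))) @: L)%VS.

Lemma act_pi (A : UJ) (v : 'cV[C]_3) :
  act (\pi_PU A) <[v]>%VS = <[UJval A *m v]>%VS.
Proof.
have [c hc] := PU_repr A; have c0 := projeq_neq0 hc.
rewrite /act hc limg_line lfunE /= -scalemxAl.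
apply/eqP; rewrite eqEsubv -!memvE; apply/andP; split.
  by apply: memvZ; exact: memv_line.
rewrite -[X in X \in _]scale1r -(mulVf c0) -scalerA.
by apply: memvZ; exact: memv_line.
Qed.

Definition quadratic_field (d : nat) : set C :=
  [set z | exists a b : rat, z = ratr a + ratr b * ('i * sqrtC d%:R)].

Definition ring_of_integers (d : nat) : set C :=
  [set z | quadratic_field d z /\ integralOver (intr : int -> C) z].

Definition GL3 (S : set C) : set 'M[C]_3 :=
  [set A | [/\ A \in unitmx, forall i j, S (A i j)
                           & forall i j, S (invmx A i j)]].

Definition Gamma (d : nat) : set PU :=
  [set \pi_PU A | A in [set A : UJ | GL3 (ring_of_integers d) (UJval A)]].

Definition H2C : set {vspace 'cV[C]_3} :=
  [set <[v]>%VS | v in [set v : 'cV[C]_3 | herm v v < 0]].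

Definition mirror (w : 'cV[C]_3) : set {vspace 'cV[C]_3} :=
  H2C `&` [set <[v]>%VS | v in [set v : 'cV[C]_3 | herm v w = 0]].

Definition is_mirror (M : set {vspace 'cV[C]_3}) : Prop :=
  exists2 w : 'cV[C]_3, 0 < herm w w & M = mirror w.

Definition fixes_pointwise (g : PU) (M : set {vspace 'cV[C]_3}) : Prop :=
  forall L, M L -> act g L = L.

Definition mirror_of (g : PU) (M : set {vspace 'cV[C]_3}) : Prop :=
  is_mirror M /\ fixes_pointwise g M.

Definition complex_reflection (g : PU) : Prop :=
  [/\ g <> 1%g, exists2 n : nat, (0 < n)%N & (g ^+ n)%g = 1%g
    & exists M, mirror_of g M].

Definition in_Gamma_orbit (d : nat) (M N : set {vspace 'cV[C]_3}) : Prop :=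
  exists2 g : PU, Gamma d g & N = act g @` M.

Definition pointwise_fixer (d : nat) (M : set {vspace 'cV[C]_3}) : set PU :=
  [set g | Gamma d g /\ fixes_pointwise g M].

Definition w1 : 'cV[C]_3 := \col_(i < 3) [:: 0; 1; 0]`_i.
Definition w2 : 'cV[C]_3 := \col_(i < 3) [:: 1; 0; 1]`_i.

End UnitaryGroup.

Definition cyclic_of_order (G : groupType) (n : nat) (H : set G) : Prop :=
  (exists g : G, H = [set (g ^+ k)%g | k in [set: nat]] `|`
                     [set (g ^- k)%g | k in [set: nat]]) /\
  (H #= `I_n)%card.

Arguments w1 R : clear implicits.
Arguments w2 R : clear implicits.
Arguments H2C R : clear implicits.

(* Main.v *)
From HB Require Import structures.
Require Import Defs.
From mathcomp Require Import all_boot all_order all_algebra.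
From mathcomp Require Import all_field generic_quotient.
From mathcomp Require Import complex boolp classical_sets cardinality reals.
From mathcomp Require Import ring zify.

(* A reflection in Gamma_d has the form x |-> a x + (b - a) <x, w> / <w, w> w up
   to scalars. Its eigenvalues are units of O_d, hence 1 or -1, and w can be
   taken primitive in O_d^3; integrality then forces <w, w> | 2, so that
   <w, w> is 1 or 2.
   If <w, w> = 1, then for u orthogonal to w the Hermitian cross product of u
   and w is orthogonal to u and has norm - <u, u>; hence w is orthogonal to a
   primitive isotropic vector v, and completing (v, w) to a basis with Gram
   matrix J maps w_1 to w.
   If <w, w> = 2, the orthogonal complement of w is a binary Hermitian form of
   determinant -2, and reduction theory (a Dedekind-Hasse argument when d = 19)
   shows that it represents 1. This reduces to w = (a, 0, c), where the isometry
   carrying w_2 to w is glued from an isometry of the form diag(1, -2).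
   The two orbits differ because the norms of primitive vectors do. *)

Set Implicit Arguments.
Unset Strict Implicit.
Unset Printing Implicit Defensive.
Import Order.TTheory GRing.Theory Num.Theory.
Local Open Scope ring_scope.

(** For these [d] one has [d = 4k - 1] with [k = 2, 3, 5], and the integers are Z + Z [tau] with
    [tau ^+ 2 = tau - k]. Three features of this ring shape the proof. Since [tau + tau^* = 1],
    every integer is a trace, so a vector can be made isotropic without dividing by 2. The norm is
    Euclidean for [k = 2, 3] but not for [k = 5]; there [2a] is divided by [b] with a quotient of
    odd norm, hence coprime to 2, and the pair completes to a matrix of determinant 1. That matrix
    serves both the Bezout identities and the reduction of binary forms. Finally, 2 splits for
    [k = 2], so that O/2 has the single unit 1, and is inert for [k = 3, 5], where O/2 is the field
    of four elements and its two other units must be lifted to isometries of diag(1, -2). *)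

Lemma integral_ratr_int (F : numFieldType) (q : rat) :
  integralOver (intr : int -> F) (ratr q) -> exists m : int, q = m%:~R.
Proof.
case=> p p_monic p_root.
have root_q : root (map_poly (intr : int -> rat) p) q.
  rewrite -(fmorph_root (ratr : rat -> F)) -map_poly_comp.
  by rewrite (eq_map_poly (g := intr)) // => x /=; rewrite ratr_int.
have : (ratr q : algC) \in Aint.
  apply: (@root_monic_Aint (map_poly intr p)).
  - have : root (map_poly (ratr : rat -> algC) (map_poly (intr : int -> rat) p)) (ratr q).
      by rewrite fmorph_root.
    rewrite -map_poly_comp (eq_map_poly (g := intr)) // => x /=; by rewrite ratr_int.
  - by rewrite monic_map.
  - by apply/polyOverP => i; rewrite coef_map /= intr_int.
move/Cint_rat_Aint => /(_ (Crat_rat q)) /intrP[m hm]; exists m.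
apply: (@fmorph_inj _ _ (ratr : rat -> algC)); exact: etrans hm (esym (ratr_int _ m)).
Qed.

(** * Rounding with respect to the norm form *)

Lemma centered_rep (v n : int) : 0 < n -> exists l : int,
  2 * (v + l * n) <= n /\ - n <= 2 * (v + l * n).
Proof.
move=> n0; exists (- ((2 * v + n) %/ (2 * n))%Z).
have := divz_eq (2 * v + n) (2 * n).
have := modz_ge0 (2 * v + n) (d := 2 * n) ltac:(lia).
have := ltz_pmod (2 * v + n) (d := 2 * n) ltac:(lia).
by move: ((2 * v + n) %/ (2 * n))%Z ((2 * v + n) %% (2 * n))%Z => q r; nia.
Qed.

Lemma sqr_le_of_abs (t n : int) : 2 * t <= 2 * n -> - (2 * n) <= 2 * t -> t ^+ 2 <= n ^+ 2.
Proof. by nia. Qed.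

(* With [d = 4k - 1], [4 (p^2 + pq + k q^2) = (2p + q)^2 + d q^2]. *)
Definition nform (k p q : int) := p ^+ 2 + p * q + k * q ^+ 2.


(** Centring [q] first and then [2p + q], which moves in steps of [2n], bounds both squares in the
    formula for [4 * nform]. The resulting factor [(4k + 3) / 16] is below 1 for [k = 2, 3] but
    equals 23/16 for [k = 5]. *)
Lemma nform_reduce (k u v n : int) : 0 < k -> 0 < n -> exists x y : int,
  let p := u + x * n in let q := v + y * n in
  [/\ (2 * p + q) ^+ 2 <= n ^+ 2, 2 * q <= n, - n <= 2 * q &
  16 * nform k p q <= (4 * k + 3) * n ^+ 2].
Proof.
move=> k0 n0.
have [y [y1 y2]] := centered_rep v n0.
have [x [x1 x2]] := @centered_rep (2 * u + v + y * n) (2 * n) ltac:(lia).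
exists x, y => p q.
have P1 : (2 * p + q) ^+ 2 <= n ^+ 2.
  have -> : 2 * p + q = 2 * u + v + y * n + x * (2 * n) by rewrite /p /q; ring.
  exact: sqr_le_of_abs.
split=> //.
have : 4 * q ^+ 2 <= n ^+ 2 by nia.
have -> : 16 * nform k p q = 4 * (2 * p + q) ^+ 2 + 4 * (4 * k - 1) * q ^+ 2.
  by rewrite /nform; ring.
move=> q2; nia.
Qed.

(* Away from the discs of radius 1 around the lattice points, doubling brings
   a point within distance 1 of a lattice point with odd tau-coordinate. *)
Lemma nform_reduce_double (u v n : int) : 0 < n ->
  (exists x y : int, nform 5 (u + x * n) (v + y * n) < n ^+ 2) \/
  (exists x y : int, nform 5 (2 * u + x * n) (2 * v + (2 * y + 1) * n) < n ^+ 2).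
Proof.
move=> n0; have [//|x [y [P1 q1 q2 _]]] := @nform_reduce 5 u v n _ n0.
have [lt|ge] := ltP (nform 5 (u + x * n) (v + y * n)) (n ^+ 2).
  by left; exists x, y.
right.
set p := u + x * n in P1 ge; set q := v + y * n in P1 q1 q2 ge.
have q3 : 3 * n ^+ 2 <= 19 * q ^+ 2.
  have : 4 * nform 5 p q = (2 * p + q) ^+ 2 + 19 * q ^+ 2 by rewrite /nform; ring.
  by move: (nform 5 p q) ge P1; nia.
(* By [q3], [q] exceeds [n / 3] in absolute value, so [2q] is within [n / 3] of [s * n] with [s] the
   sign of [q]; and 19/9 < 3. *)
have [s [s1 s2]] : exists s : int, (s = 1 \/ s = -1) /\ 19 * (2 * q - s * n) ^+ 2 < 3 * n ^+ 2.
  have [q0|q0] := leP 0 q.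
    by exists 1; split; [left | have : n < 3 * q by nia]; nia.
  by exists (-1); split; [right | have : n < - (3 * q) by nia]; nia.
have [z [z1 z2]] := @centered_rep (2 * (2 * p) + (2 * q - s * n)) (2 * n) ltac:(lia).
pose e := 2 * q - s * n.
have B : nform 5 (2 * p + z * n) e < n ^+ 2.
  have : 4 * nform 5 (2 * p + z * n) e = (2 * (2 * p) + e + z * (2 * n)) ^+ 2 + 19 * e ^+ 2.
    by rewrite /nform; ring.
  move: z1 z2 s2; rewrite -/e.
  move: (2 * (2 * p) + e + z * (2 * n)) => t t1 t2 e2.
  have := sqr_le_of_abs t1 t2.
  by move: (nform _ _ _) (t ^+ 2) (e ^+ 2) (n ^+ 2) e2 => N T E M; lia.
case: s1 => s1; [exists (2 * x + z), (y - 1) | exists (2 * x + z), y];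
  apply: le_lt_trans B; rewrite le_eqVlt; apply/orP; left; apply/eqP;
  rewrite /nform /e /p /q s1; ring.
Qed.

Ltac conj_ring :=
  rewrite ?(rmorphD, rmorphB, rmorphN, rmorphM, rmorphXn, rmorph0, rmorph1, rmorph_nat, rmorph_int) /= ?conjCK;
  ring.

Ltac conj_field :=
  rewrite ?(fmorphV, rmorphD, rmorphB, rmorphN, rmorphM, rmorphXn, rmorph0, rmorph1, rmorph_nat, rmorph_int) /= ?conjCK;
  field.

(* Locked, because the rmorphism lemmas would otherwise rewrite inside it. *)
HB.lock Definition tau (R : realType) (d : nat) : R[i] := (1 + 'i * sqrtC d%:R) / 2.

(** * The ring Z + Z [tau] and its norm *)

Section QuadraticIntegers.
Variables (R : realType) (d : nat).
Local Notation C := R[i].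

Definition delta : C := 'i * sqrtC d%:R.
Local Notation tau := (tau R d).
Definition zi (z : C) : Prop := exists m n : int, z = m%:~R + n%:~R * tau.

Lemma delta_conj : delta^* = - delta.
Proof.
rewrite /delta rmorphM /= conjCi mulNr; congr (- (_ * _)).
by apply: conj_Creal; rewrite ger0_real // sqrtC_ge0 ler0n.
Qed.

Lemma delta_sqr : delta ^+ 2 = - d%:R.
Proof. by rewrite /delta exprMn sqrCi sqrtCK mulN1r. Qed.

Lemma tau_conj : tau^* = 1 - tau.
Proof. by rewrite tau.unlock -/delta rmorphM fmorphV rmorphD rmorph1 rmorph_nat /= delta_conj; field. Qed.

Lemma delta_tau : delta = 2 * tau - 1.
Proof. by rewrite tau.unlock -/delta; field. Qed.

Hypothesis hd : d \in [:: 7; 11; 19]%N.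

(** The norm of [tau]. *)
Definition kd : nat := (d.+1 %/ 4)%N.

Lemma kdP : d.+1 = (4 * kd)%N.
Proof. by move: hd; rewrite /kd !inE => /or3P[] /eqP->. Qed.

Lemma kd_cases : [\/ kd = 2, kd = 3 | kd = 5].
Proof.
by move: hd; rewrite /kd !inE => /or3P[] /eqP->; [constructor 1|constructor 2|constructor 3].
Qed.

Lemma kd_gt1 : (1 < kd)%N.
Proof. by case: kd_cases => ->. Qed.

Lemma tau_sqr : tau ^+ 2 = tau - kd%:R.
Proof.
have -> : tau ^+ 2 = (1 + 2 * delta + delta ^+ 2) / 4 by rewrite tau.unlock -/delta; field.
have -> : (kd%:R : C) = (d%:R + 1) / 4.
  by rewrite -(natrD _ d 1) addn1 kdP natrM; field.
by rewrite delta_sqr tau.unlock -/delta; field.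
Qed.

Lemma zi_int (m : int) : zi m%:~R.
Proof. by exists m, 0; rewrite mul0r addr0. Qed.
Lemma zi_nat (m : nat) : zi m%:R.
Proof. exact: (zi_int m). Qed.
Lemma zi0 : zi 0. Proof. exact: (zi_int 0). Qed.
Lemma zi1 : zi 1. Proof. exact: (zi_int 1). Qed.
Lemma zi_tau : zi tau.
Proof. by exists 0, 1; rewrite mul1r add0r. Qed.
Lemma ziD x y : zi x -> zi y -> zi (x + y).
Proof.
by move=> [m [n ->]] [p [q ->]]; exists (m + p), (n + q); rewrite !rmorphD /=; ring.
Qed.
Lemma ziN x : zi x -> zi (- x).
Proof. by move=> [m [n ->]]; exists (- m), (- n); rewrite !rmorphN /=; ring. Qed.
Lemma ziM x y : zi x -> zi y -> zi (x * y).
Proof.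
move=> [m [n ->]] [p [q ->]]; exists (m * p - kd%:Z * n * q), (m * q + n * p + n * q).
rewrite !(rmorphD, rmorphN, rmorphM) /= -[kd%:~R]/(kd%:R : C).
have -> : (kd%:R : C) = tau - tau ^+ 2 by rewrite tau_sqr; ring.
ring.
Qed.
Lemma zi_conj x : zi x -> zi x^*.
Proof.
move=> [m [n ->]]; exists (m + n), (- n).
by rewrite !(rmorphD, rmorphN, rmorphM, rmorph_int) /= tau_conj; ring.
Qed.

Lemma normE (m n : int) :
  (m%:~R + n%:~R * tau) * (m%:~R + n%:~R * tau)^* = (nform kd%:Z m n)%:~R :> C.
Proof.
rewrite /nform !(rmorphD, rmorphN, rmorphM, rmorph_int, rmorphXn) /= tau_conj.
rewrite -[kd%:~R]/(kd%:R : C).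
have -> : (kd%:R : C) = tau - tau ^+ 2 by rewrite tau_sqr; ring.
ring.
Qed.

Lemma nform_ge0 (m n : int) : 0 <= nform kd%:Z m n.
Proof.
have : 0 <= (2 * m + n) ^+ 2 + (4 * kd%:Z - 1) * n ^+ 2.
  apply: addr_ge0 (sqr_ge0 _) (mulr_ge0 _ (sqr_ge0 _)).
  by move: kd kd_gt1 => k hk; lia.
have -> : (2 * m + n) ^+ 2 + (4 * kd%:Z - 1) * n ^+ 2 = 4 * nform kd%:Z m n.
  by rewrite /nform; ring.
by move: (nform _ _ _) => N; lia.
Qed.

Lemma zi_norm z : zi z -> exists N : nat, z * z^* = N%:R.
Proof.
move=> [m [n ->]]; rewrite normE.
by have := nform_ge0 m n; case: (nform _ _ _) => // N _; exists N.
Qed.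

Lemma zi_real z : zi z -> z^* = z -> exists m : int, z = m%:~R.
Proof.
move=> [m [n ->]] h; exists m.
suff -> : n = 0 by rewrite mul0r addr0.
move: h; rewrite !(rmorphD, rmorphN, rmorphM, rmorph_int) /= tau_conj => h.
have h2 : (n%:~R : C) * (2 * tau - 1) = 0.
  transitivity (m%:~R + n%:~R * tau - (m%:~R + n%:~R * (1 - tau)) : C); first by ring.
  by rewrite h subrr.
have : ((n ^+ 2 * d%:Z)%:~R : C) = 0.
  rewrite rmorphM rmorphXn /= -[d%:~R]/(d%:R : C).
  have -> : (d%:R : C) = - (2 * tau - 1) ^+ 2 by rewrite -delta_tau delta_sqr opprK.
  by rewrite mulrN -exprMn h2 expr0n oppr0.
move/eqP; rewrite intr_eq0 mulf_eq0 sqrf_eq0; have := kdP; have := kd_gt1.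
by case/orP: (orbN (n == 0)) => /eqP // _ h3 h4; lia.
Qed.

(** Four times the norm is [(2m + n)^2 + d n^2] with [d > 4], so norm 1 forces [n = 0]. *)
Lemma zi_unit z : zi z -> z * z^* = 1 -> z = 1 \/ z = -1.
Proof.
move=> [m [n ->]]; rewrite normE => /eqP; rewrite -[1]/(1%:~R) eqr_int => /eqP.
rewrite /nform => h.
have n0 : n = 0.
  have : (2 * m + n) ^+ 2 + (4 * kd%:Z - 1) * n ^+ 2 = 4.
    transitivity (4 * (m ^+ 2 + m * n + kd%:Z * n ^+ 2)); first by ring.
    by rewrite h.
  have := sqr_ge0 (2 * m + n); move: ((2 * m + n) ^+ 2) kd kd_gt1 => s k hk s0 h'.
  by nia.
have : m = 1 \/ m = -1 by move: h; rewrite n0; nia.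
by rewrite n0; case=> ->; [left | right]; rewrite mul0r addr0 // rmorphN.
Qed.

(** This separates the two orbits, and shows that an element of norm 2 is not a unit. *)
Lemma zi_norm_half z : zi z -> 2 * (z * z^*) <> 1.
Proof.
move=> /zi_norm[N ->] /eqP; rewrite -natrM -[1]/(1%:R) eqr_nat.
by case: N => // N /eqP; lia.
Qed.

Lemma norm_eq0 (z : C) : (z * z^* == 0) = (z == 0).
Proof. by rewrite mulf_eq0 conjC_eq0 orbb. Qed.

End QuadraticIntegers.
#[export] Hint Resolve zi0 zi1 zi_int zi_nat zi_tau ziD ziN ziM zi_conj : zi.
Ltac solve_zi := auto 30 with zi.

(** * Division with remainder and Bezout identities *)

Section Reduction.
Variables (R : realType) (d : nat).
Local Notation C := R[i].
Local Notation zi := (@zi R d).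
Local Notation tau := (@tau R d).
Hypothesis hd : d \in [:: 7; 11; 19]%N.

(** Multiplying by [b^*] turns division by [b] into division of [a * b^* = u + v tau] by the
    positive integer [n], to which the rounding lemmas apply. *)
Lemma zi_coord (a b : C) : zi a -> zi b -> b != 0 -> exists u v n : int,
  [/\ 0 < n, b * b^* = n%:~R,
   forall x y : int, (a + (x%:~R + y%:~R * tau) * b) * (a + (x%:~R + y%:~R * tau) * b)^* * n%:~R
     = (nform (kd d) (u + x * n) (v + y * n))%:~R &
   forall x y : int, (2 * a + (x%:~R + y%:~R * tau) * b) * (2 * a + (x%:~R + y%:~R * tau) * b)^* * n%:~R
     = (nform (kd d) (2 * u + x * n) (2 * v + y * n))%:~R].
Proof.
move=> za zb b0; have [N hN] := zi_norm hd zb.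
have [u [v huv]] := ziM hd za (zi_conj zb).
exists u, v, N; split=> //.
- have : (N%:R : C) != 0 by rewrite -hN norm_eq0.
  by rewrite pnatr_eq0; lia.
- move=> x y; rewrite -[N%:~R]/(N%:R : C) -normE // -hN.
  have -> : (u + x * N)%:~R + (v + y * N)%:~R * tau = (a + (x%:~R + y%:~R * tau) * b) * b^*.
    rewrite mulrDl huv -mulrA hN !(rmorphD, rmorphM) /= -[N%:~R]/(N%:R : C); ring.
  move: (a + _ * b) => X; conj_ring.
move=> x y; rewrite -[N%:~R]/(N%:R : C) -normE // -hN.
have -> : (2 * u + x * N)%:~R + (2 * v + y * N)%:~R * tau = (2 * a + (x%:~R + y%:~R * tau) * b) * b^*.
  rewrite [(_ + _ * b) * _]mulrDl -[2 * a * _]mulrA huv -mulrA hN !(rmorphD, rmorphM) /= -[N%:~R]/(N%:R : C); ring.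
move: (2 * a + _ * b) => X; conj_ring.
Qed.

Lemma zi_reduce_weak a b : zi a -> zi b -> b != 0 ->
  exists2 x, zi x & 16 * ((a + x * b) * (a + x * b)^*) <= (4 * kd d + 3)%N%:R * (b * b^*).
Proof.
move=> za zb b0; have [u [v [n [n0 hn h _]]]] := zi_coord za zb b0.
have [|x [y [_ _ _ le]]] := @nform_reduce (kd d) u v n _ n0; first by have := kd_gt1 hd; lia.
exists (x%:~R + y%:~R * tau); first by exists x, y.
have n0' : (0 : C) < n%:~R by rewrite ltr0z.
rewrite -(ler_pM2r n0') -mulrA h hn -mulrA -expr2 -[16]/((Posz 16)%:~R) -[(_)%N%:R]/((Posz (_)%N)%:~R).
by rewrite -!rmorphXn -!rmorphM ler_int /=; lia.
Qed.

(** In the second alternative [t] has odd [tau]-coordinate, hence odd norm. The relation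
    [t * t^* - 2 * j = 1] makes [(2, t)] a row of a matrix of determinant 1, which allows [2a + t b]
    to replace [a + x b]. *)
Lemma zi_reduce a b : zi a -> zi b -> b != 0 ->
  (exists2 x, zi x & (a + x * b) * (a + x * b)^* < b * b^*) \/
  (kd d = 5 /\ exists t, exists j : int, [/\ zi t, t * t^* = 1 + 2 * j%:~R &
    (2 * a + t * b) * (2 * a + t * b)^* < b * b^*]).
Proof.
move=> za zb b0; have [u [v [n [n0 hn h h2]]]] := zi_coord za zb b0.
have n0' : (0 : C) < n%:~R by rewrite ltr0z.
have [k5|k5] := eqVneq (kd d) 5.
  have [[x [y lt]]|[x [y lt]]] := nform_reduce_double u v n0.
    left; exists (x%:~R + y%:~R * tau); first by exists x, y.
    by rewrite -(ltr_pM2r n0') h hn -expr2 -!rmorphXn ltr_int k5.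
  right; split=> //; exists (x%:~R + (2 * y + 1)%:~R * tau).
  have [j hj] : exists j, x * (x + 1) = 2 * j.
    have [e [->|->]] : exists e : int, x = 2 * e \/ x = 2 * e + 1.
      by exists (x %/ 2)%Z; lia.
    - by exists (e * (2 * e + 1)); ring.
    - by exists ((2 * e + 1) * (e + 1)); ring.
  pose J := j + x * y + 10 * y ^+ 2 + 10 * y + 2; exists J; split.
  - by exists x, (2 * y + 1).
  - rewrite normE // k5; transitivity ((1 + 2 * J)%:~R : C); last by rewrite rmorphD rmorphM.
    by congr (_ %:~R); rewrite /nform /J; move: hj; lia.
  by rewrite -(ltr_pM2r n0') h2 hn -expr2 -!rmorphXn ltr_int k5.
left; have [|x [y [_ _ _ le]]] := @nform_reduce (kd d) u v n _ n0; first by have := kd_gt1 hd; lia.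
exists (x%:~R + y%:~R * tau); first by exists x, y.
rewrite -(ltr_pM2r n0') h hn -expr2 -!rmorphXn ltr_int.
move: le; case: (kd_cases hd) k5 => -> // _ le; first by nia.
by nia.
Qed.

Lemma zi_bezout a b : zi a -> zi b -> exists g x y a' b',
  [/\ zi x, zi y, zi a' & zi b'] /\ [/\ g = x * a + y * b, a = a' * g & b = b' * g].
Proof.
move=> za zb; have [N hN] := zi_norm hd zb.
elim/ltn_ind: N a b za zb hN => N IH a b za zb hN.
have [b0|b0] := eqVneq b 0.
  by exists a, 1, 0, 1, 0; split; split; rewrite ?b0; solve_zi; ring.
have [[X zX]|[_ [t [j [zt ht]]]]] := zi_reduce za zb b0.
  have zr : zi (a + X * b) by solve_zi.
  have [M hM] := zi_norm hd zr; rewrite hM hN ltr_nat => lt.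
  have [g [x [y [b' [r' [[zx zy zb' zr'] [gE bE rE]]]]]]] := IH M lt b (a + X * b) zb zr hM.
  exists g, y, (x + y * X), (r' - X * b'), b'; split; first by split; solve_zi.
  split=> //; first by rewrite gE; ring.
  by rewrite mulrBl -rE -mulrA -bE; ring.
have zr : zi (2 * a + t * b) by solve_zi.
(* The rows [(2, t)] and [(- t^*, - j)] have determinant [t t^* - 2 j = 1], so the new pair
   generates the same ideal as [a] and [b]; the cofactors below come from the inverse matrix. *)
have zs : zi (- t^* * a - j%:~R * b) by solve_zi.
have [M hM] := zi_norm hd zr; rewrite hM hN ltr_nat => lt.
have [g [x [y [s' [r' [[zx zy zs' zr'] [gE sE rE]]]]]]] := IH M lt _ _ zs zr hM.
exists g, (2 * y - x * t^*), (y * t - x * j%:~R), (- j%:~R * r' - t * s'), (t^* * r' + 2 * s').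
split; first by split; solve_zi.
split.
- by rewrite gE; ring.
- rewrite mulrBl -!mulrA -rE -sE.
  transitivity (a * (t * t^* - 2 * j%:~R)); last by ring.
  by rewrite ht; ring.
rewrite mulrDl -!mulrA -rE -sE.
transitivity (b * (t * t^* - 2 * j%:~R)); last by ring.
by rewrite ht; ring.
Qed.

End Reduction.

(** * Coordinates, Gram matrices and the cross product on C^3 *)

Definition i0 : 'I_3 := @Ordinal 3 0 isT.
Definition i1 : 'I_3 := @Ordinal 3 1 isT.
Definition i2 : 'I_3 := @Ordinal 3 2 isT.

Lemma forall_ord3 (P : 'I_3 -> Prop) : P i0 -> P i1 -> P i2 -> forall i, P i.
Proof.
move=> h0 h1 h2 [[|[|[|//]]] lt_i].
- by rewrite (_ : Ordinal lt_i = i0) //; apply: val_inj.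
- by rewrite (_ : Ordinal lt_i = i1) //; apply: val_inj.
- by rewrite (_ : Ordinal lt_i = i2) //; apply: val_inj.
Qed.

Lemma sum_ord3 (V : nmodType) (F : 'I_3 -> V) : \sum_i F i = F i0 + F i1 + F i2.
Proof.
rewrite !big_ord_recr big_ord0 /= add0r.
by congr (F _ + F _ + F _); apply: val_inj.
Qed.

Section HermitianSpace.
Variable R : realType.
Local Notation C := R[i].
Implicit Types (u v w : 'cV[C]_3) (A B : 'M[C]_3).

Definition col3 (a b c : C) : 'cV[C]_3 := \col_i [:: a; b; c]`_i.

Definition cols3 u v w : 'M[C]_3 := \matrix_(i, j) [:: u i ord0; v i ord0; w i ord0]`_j.

Lemma colvecP u v : u i0 ord0 = v i0 ord0 -> u i1 ord0 = v i1 ord0 ->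
  u i2 ord0 = v i2 ord0 -> u = v.
Proof. by move=> h0 h1 h2; apply/colP; apply: forall_ord3. Qed.

Lemma hermE v w : herm v w =
  v i0 ord0 * (w i2 ord0)^* + v i1 ord0 * (w i1 ord0)^* + v i2 ord0 * (w i0 ord0)^*.
Proof.
rewrite /herm /ctrmx /J !mxE sum_ord3 !mxE !sum_ord3 !mxE /=; ring.
Qed.

Lemma herm_conj v w : herm w v = (herm v w)^*.
Proof. by rewrite !hermE; conj_ring. Qed.

Lemma hermDl u v w : herm (u + v) w = herm u w + herm v w.
Proof. by rewrite !hermE !mxE; ring. Qed.
Lemma hermZl a v w : herm (a *: v) w = a * herm v w.
Proof. by rewrite !hermE !mxE; ring. Qed.
Lemma hermDr u v w : herm w (u + v) = herm w u + herm w v.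
Proof. by rewrite !hermE !mxE; conj_ring. Qed.
Lemma hermZr a v w : herm w (a *: v) = a^* * herm w v.
Proof. by rewrite !hermE !mxE; conj_ring. Qed.
Lemma hermNl v w : herm (- v) w = - herm v w.
Proof. by rewrite -scaleN1r hermZl mulN1r. Qed.
Lemma hermNr v w : herm w (- v) = - herm w v.
Proof. by rewrite -scaleN1r hermZr rmorphN rmorph1 mulN1r. Qed.
Definition herm_lin := (hermDl, hermDr, hermNl, hermNr, hermZl, hermZr).

Lemma herm_perp_sym v w : herm v w = 0 -> herm w v = 0.
Proof. by move=> h; rewrite herm_conj h rmorph0. Qed.

Lemma gramE A B i j : (ctrmx A *m J R *m B) i j = herm (col j B) (col i A).
Proof.
rewrite /herm !mxE; apply: eq_bigr => k _; rewrite !mxE; congr (_ * _).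
by apply: eq_bigr => l _; rewrite !mxE.
Qed.

Lemma J_involutive : J R *m J R = 1%:M.
Proof.
apply/matrixP; apply: forall_ord3; apply: forall_ord3;
  rewrite !mxE sum_ord3 !mxE /=; ring.
Qed.

Lemma unitaryJP A : reflect (ctrmx A *m J R *m A = J R) (unitaryJ A).
Proof.
apply: (iffP andP) => [[_ /eqP //]|h]; split; last by apply/eqP.
have : J R *m ctrmx A *m J R *m A = 1%:M by rewrite -!mulmxA (mulmxA _ (J R)) h J_involutive.
by case/mulmx1_unit.
Qed.

Lemma unitaryJ_inv A : unitaryJ A -> invmx A = J R *m ctrmx A *m J R.
Proof.
move=> uA; have /unitaryJP h := uA; case/andP: uA => uA _.
have h2 : J R *m ctrmx A *m J R *m A = 1%:M.
  by rewrite -!mulmxA (mulmxA _ (J R)) h J_involutive.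
by rewrite -[RHS]mulmx1 -(mulmxV uA) mulmxA h2 mul1mx.
Qed.

Lemma herm_rowE v w : ctrmx w *m J R *m v = (herm v w)%:M.
Proof. by apply/matrixP => i j; rewrite !ord1 [RHS]mxE /= mulr1n. Qed.

Lemma herm_unitary A v w : unitaryJ A -> herm (A *m v) (A *m w) = herm v w.
Proof.
move=> /unitaryJP h; rewrite /herm ctrmxM.
by rewrite !mulmxA -[ctrmx w *m _ *m _]mulmxA -[ctrmx w *m _ *m A]mulmxA h.
Qed.

Lemma cols3_mul u v w x : cols3 u v w *m x =
  x i0 ord0 *: u + x i1 ord0 *: v + x i2 ord0 *: w.
Proof.
by apply/colP => i; rewrite !mxE sum_ord3 !mxE /=; ring.
Qed.

Lemma col_cols3 u v w : (col i0 (cols3 u v w) = u) * (col i1 (cols3 u v w) = v) *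
  (col i2 (cols3 u v w) = w).
Proof. by do !split; apply/colP => i; rewrite !mxE. Qed.

Lemma unitaryJ_cols3 u v w : herm u u = 0 -> herm v v = 1 -> herm w w = 0 ->
  herm u v = 0 -> herm u w = 1 -> herm v w = 0 -> unitaryJ (cols3 u v w).
Proof.
move=> uu vv ww uv uw vw; apply/unitaryJP/matrixP.
by apply: forall_ord3; apply: forall_ord3; rewrite gramE !col_cols3 ?uu ?vv ?ww ?uv ?uw ?vw
  ?(herm_conj u) ?(herm_conj v w) ?uv ?uw ?vw ?rmorph0 ?rmorph1 mxE.
Qed.

(** The conjugations and the order of the entries are chosen so that [herm x (cross u w)] is the
    determinant of [x], [u], [w]. *)
Definition cross u w : 'cV[C]_3 :=
  col3 (u i0 ord0 * w i1 ord0 - u i1 ord0 * w i0 ord0)^*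
       (u i2 ord0 * w i0 ord0 - u i0 ord0 * w i2 ord0)^*
       (u i1 ord0 * w i2 ord0 - u i2 ord0 * w i1 ord0)^*.

Lemma herm_cross_l u w : herm u (cross u w) = 0.
Proof. by rewrite hermE !mxE /= !conjCK; ring. Qed.
Lemma herm_cross_r u w : herm w (cross u w) = 0.
Proof. by rewrite hermE !mxE /= !conjCK; ring. Qed.

Lemma herm_cross_cross u w :
  herm (cross u w) (cross u w) = herm u w * herm w u - herm u u * herm w w.
Proof. by rewrite !hermE !mxE /=; conj_ring. Qed.

(** The left side is the Gram determinant of [w], [u], [v]; the sign on the right is the determinant
    of [J]. *)
Lemma gram_det u v w :
  herm w w * (herm u u * herm v v - herm u v * herm v u)
  - herm w u * (herm u w * herm v v - herm u v * herm v w)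
  + herm w v * (herm u w * herm v u - herm u u * herm v w)
  = - (herm u (cross v w) * (herm u (cross v w))^*).
Proof. rewrite !hermE !mxE /=; conj_ring. Qed.

End HermitianSpace.

(** * Binary Hermitian forms of determinant -2 *)

Lemma absz_lt_of_mul (a b : int) : - (a ^+ 2) < a * b -> a * b < a ^+ 2 -> (`|b| < `|a|)%N.
Proof.
move=> h1 h2; have : `|a * b| < `|a| ^+ 2 by rewrite ltr_norml real_normK ?num_real // h1 h2.
rewrite normrM expr2 => h; have a0 : 0 < `|a|.
  by rewrite normr_gt0; apply/eqP => a0; move: h; rewrite a0 normr0 !mul0r ltxx.
by move: h; rewrite ltr_pM2l //; lia.
Qed.

Section BinaryForms.
Variables (R : realType) (d : nat).
Local Notation C := R[i].
Local Notation zi := (@zi R d).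
Local Notation tau := (@tau R d).
Hypothesis hd : d \in [:: 7; 11; 19]%N.

Definition bform (A B : int) (b x y : C) : C :=
  A%:~R * (x * x^*) + B%:~R * (y * y^*) + b * x * y^* + b^* * x^* * y.

Lemma bform_int A B b x y : zi b -> zi x -> zi y -> exists m : int, bform A B b x y = m%:~R.
Proof.
move=> zb zx zy; apply: (zi_real hd).
  by rewrite /bform; solve_zi.
by rewrite /bform; conj_ring.
Qed.

(** Completing the square. At [y = 1] and [y = 2] the correction is 2 and 8, the source of the
    [M - 2] and [M - 8] of the reduction. *)
Lemma bform_mulA A B b x y : (A%:~R * B%:~R - b * b^* : C) = - 2 ->
  A%:~R * bform A B b x y = (b^* * y + x * A%:~R) * (b^* * y + x * A%:~R)^* - 2 * (y * y^*).
Proof.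
move=> h; transitivity ((b^* * y + x * A%:~R) * (b^* * y + x * A%:~R)^*
  + (A%:~R * B%:~R - b * b^*) * (y * y^*)); last by rewrite h; ring.
by rewrite /bform; conj_ring.
Qed.

(** With trace [s], the equation [s^2 + d n^2 = 8] is solvable only for [d = 7], where [s] and [n]
    are 1 up to sign. *)
Lemma trace_of_norm2 b : zi b -> b * b^* = 2 -> exists2 s : int, b + b^* = s%:~R & s * s = 1.
Proof.
move=> [m [n ->]]; rewrite normE // => /eqP; rewrite -[2]/((Posz 2)%:~R) eqr_int => /eqP h.
exists (2 * m + n).
  by rewrite !(rmorphD, rmorphM, rmorph_int) /= tau_conj; ring.
have h8 : (2 * m + n) ^+ 2 + (4 * (kd d)%:Z - 1) * n ^+ 2 = 8.
  transitivity (4 * nform (kd d)%:Z m n); first by rewrite /nform; ring.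
  by rewrite h.
have : (2 * m + n) ^+ 2 <= 8.
  move: (sqr_ge0 n) h8; move: (n ^+ 2) ((2 * m + n) ^+ 2) => N S.
  by case: (kd_cases hd) => ->; lia.
move: (2 * m + n) h8 => s h8 s8.
have s2 : -2 <= s <= 2 by nia.
have n1 : -1 <= n <= 1 by case: (kd_cases hd) h8 => ->; nia.
have {n1} : [\/ n = -1, n = 0 | n = 1] by case: (ltgtP n 0) => n0; [constructor 1|constructor 3|constructor 2]; lia.
have {s2} : [|| s == -2, s == -1, s == 0, s == 1 | s == 2] by lia.
case/or4P => [/eqP|/eqP|/eqP|/orP[]/eqP] hs; case=> hn; move: h8; rewrite hs hn;
  case: (kd_cases hd) => -> /eqP; by vm_compute.
Qed.

(* Reduction theory: the form of determinant [-2] is replaced by an equivalent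
   one with smaller leading coefficient until that coefficient is [0] or [1] up to sign. *)
Lemma bform_rep1 (A B : int) b : zi b -> (A%:~R * B%:~R - b * b^* : C) = - 2 ->
  exists x y, [/\ zi x, zi y & bform A B b x y = 1].
Proof.
have [n] := ubnP `|A|%N; elim: n A B b => // n IH A B b lt_An zb det.
have step (A' B' : int) b' x1 y1 x2 y2 : zi b' -> zi x1 -> zi y1 -> zi x2 -> zi y2 ->
    (`|A'| < `|A|)%N -> (A'%:~R * B'%:~R - b' * b'^* : C) = - 2 ->
    (forall x y, bform A B b (x1 * x + x2 * y) (y1 * x + y2 * y) = bform A' B' b' x y) ->
    exists x y, [/\ zi x, zi y & bform A B b x y = 1].
  move=> zb' zx1 zy1 zx2 zy2 lt det' E.
  have [|x [y [zx zy f1]]] := IH A' B' b' _ zb' det'; first by lia.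
  exists (x1 * x + x2 * y), (y1 * x + y2 * y).
  by rewrite E; split=> //; solve_zi.
(* The value at an integer [x] and [y = 1] is then [B + x (b + b^*] [)], where [b] has norm 2 and so
   trace 1 or -1. *)
have [A0|A0] := eqVneq A 0.
  have [s bs s1] : exists2 s : int, b + b^* = s%:~R & s * s = 1.
    by apply: trace_of_norm2 => //; rewrite -[LHS]opprK -[2]opprK -det A0; ring.
  exists ((s * (1 - B))%:~R), 1; split; solve_zi.
  transitivity (B%:~R + (s * (1 - B))%:~R * (b + b^*)).
    by rewrite /bform A0; conj_ring.
  rewrite bs -[B%:~R + _]/(_) -rmorphM -rmorphD /=.
  transitivity ((B + s * s * (1 - B))%:~R : C); first by congr (_%:~R); ring.
  by rewrite s1 mul1r addrC subrK.
have [A1|A1] := eqVneq A 1.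
  by exists 1, 0; split; solve_zi; rewrite /bform A1; conj_ring.
(* Here the form is [2 |y|^2 - |x - b^* y|^2], which is 1 when [y = 1] and [x - b^* = 1]. *)
have [AN1|AN1] := eqVneq A (-1).
  exists (b^* + 1), 1; split; solve_zi.
  transitivity (- (A%:~R * B%:~R - b * b^*) - 1 : C).
    by rewrite /bform AN1; conj_ring.
  by rewrite det; ring.
have zA : (A%:~R : C) != 0 by rewrite intr_eq0.
have AA : A%:~R * (A%:~R)^* = (A ^+ 2)%:~R :> C by rewrite rmorph_int expr2 intrM.
have one x (M : nat) : zi x -> (b^* + x * A%:~R) * (b^* + x * A%:~R)^* = M%:R ->
    M%:Z - 2 < A ^+ 2 -> exists x y, [/\ zi x, zi y & bform A B b x y = 1].
  move=> zx hM lt; have [A' hA'] := bform_int A B zb zx (zi1 _ _).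
  have AA' : A * A' = M%:Z - 2.
    apply: (@intr_inj C); rewrite rmorphM rmorphB /= -hA' bform_mulA // rmorph1 !mulr1 hM; ring.
  apply: (step A' A (- (x * A%:~R + b^*)) x 1 (-1) 0); solve_zi.
  - by apply: absz_lt_of_mul; rewrite AA' //; nia.
  - rewrite mulrC -rmorphM AA' rmorphB /= -[M%:~R]/(M%:R : C) -hM; conj_ring.
  - by move=> u v; rewrite {2}/bform -hA' /bform; conj_ring.
(* The doubled reduction yields [A A' = M - 8] with [0 <= M < A^2], a descent only if [A^2 > 8]. For
   [A^2 = 4] the weak bound suffices: it gives [M <= 5], so [M - 2 < 4]. *)
have [A2|A2] := eqVneq (A ^+ 2) 4.
  have [x zx] := zi_reduce_weak hd (zi_conj zb) (zi_int R d A) zA.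
  have [M hM] := zi_norm hd (ziD (zi_conj zb) (ziM hd zx (zi_int R d A))).
  rewrite hM AA A2 -[(Posz 4)%:~R]/(4%:R : C) -!natrM ler_nat => le.
  by apply: (one x M) => //; rewrite A2; case: (kd_cases hd) le => ->; lia.
have A9 : 9 <= A ^+ 2.
  have A2' : A != 2 by apply: contra_neq A2 => ->.
  have AN2 : A != -2 by apply: contra_neq A2 => ->.
  have [A3|A3] : 3 <= A \/ A <= -3 by lia.
    by nia.
  by nia.
have [[x zx]|[k5 [t [j [zt tt]]]]] := zi_reduce hd (zi_conj zb) (zi_int R d A) zA.
  have [M hM] := zi_norm hd (ziD (zi_conj zb) (ziM hd zx (zi_int R d A))).
  rewrite hM AA -[M%:R]/(M%:~R) ltr_int => lt.
  by apply: (one x M) => //; lia.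
have z2 : zi 2 by solve_zi.
have [M hM] := zi_norm hd (ziD (ziM hd z2 (zi_conj zb)) (ziM hd zt (zi_int R d A))).
rewrite hM AA -[M%:R]/(M%:~R) ltr_int => lt.
have [A' hA'] := bform_int A B zb zt z2.
have [B' hB'] := bform_int A B zb (zi_int R d j) (zi_conj zt).
have AA' : A * A' = M%:Z - 8.
  apply: (@intr_inj C); rewrite rmorphM rmorphB /= -hA' bform_mulA // rmorph_nat -[M%:~R]/(M%:R : C) -hM; conj_ring.
(* The new basis vectors [(t, 2)] and [(j, t^* )] have determinant [t t^* - 2 j = 1]; the
   off-diagonal coefficient is the value of the sesquilinear form on them. *)
apply: (step A' B' (A%:~R * t * j%:~R + b * t * t + 2 * j%:~R * b^* + 2 * B%:~R * t) t 2 j%:~R t^*); solve_zi.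
- by apply: absz_lt_of_mul; rewrite AA'; lia.
- transitivity ((A%:~R * B%:~R - b * b^*) * (t * t^* - 2 * j%:~R) ^+ 2).
    by rewrite -hA' -hB' /bform; conj_ring.
  by rewrite det tt; ring.
- by move=> u v; rewrite {2}/bform -hA' -hB' /bform; conj_ring.
Qed.

End BinaryForms.

(** * Integral and primitive vectors; the orbit of norm 1 *)

Section IntegralVectors.
Variables (R : realType) (d : nat).
Local Notation C := R[i].
Local Notation zi := (@zi R d).
Local Notation tau := (@tau R d).
Hypothesis hd : d \in [:: 7; 11; 19]%N.
Implicit Types (u v w x : 'cV[C]_3) (A B : 'M[C]_3).

Definition zvec m n (A : 'M[C]_(m, n)) : Prop := forall i j, zi (A i j).
(** A Bezout identity for the entries of [w], stated through [herm] so that isometries visibly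
    preserve it. *)
Definition primitive w : Prop := exists2 x, zvec x & herm x w = 1.

Lemma zvec_col3 (a b c : C) : zi a -> zi b -> zi c -> zvec (col3 a b c).
Proof. by move=> za zb zc; apply: forall_ord3 => j; rewrite mxE. Qed.

Lemma zvecD m n (A B : 'M[C]_(m, n)) : zvec A -> zvec B -> zvec (A + B).
Proof. by move=> zA zB i j; rewrite mxE; apply: ziD. Qed.
Lemma zvecZ m n a (A : 'M[C]_(m, n)) : zi a -> zvec A -> zvec (a *: A).
Proof. by move=> za zA i j; rewrite mxE; apply: ziM. Qed.
Lemma zvecN m n (A : 'M[C]_(m, n)) : zvec A -> zvec (- A).
Proof. by move=> zA i j; rewrite mxE; apply: ziN. Qed.
Lemma zvecM m n (A : 'M[C]_(m, 3)) (B : 'M[C]_(3, n)) : zvec A -> zvec B -> zvec (A *m B).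
Proof. by move=> zA zB i j; rewrite mxE sum_ord3; have := ziM; have := ziD; auto 10. Qed.

Lemma zvec_cols3 u v w : zvec u -> zvec v -> zvec w -> zvec (cols3 u v w).
Proof.
by move=> zu zv zw i; apply: forall_ord3; rewrite mxE; [apply: zu|apply: zv|apply: zw].
Qed.

Lemma zvec_J : zvec (J R).
Proof. by move=> i j; rewrite mxE; solve_zi. Qed.

Lemma zvec_inv A : unitaryJ A -> zvec A -> zvec (invmx A).
Proof.
move=> uA zA; rewrite unitaryJ_inv //; apply: zvecM; last exact: zvec_J.
apply: zvecM; first exact: zvec_J.
by move=> i j; rewrite !mxE; apply: zi_conj.
Qed.

Lemma zi_herm v w : zvec v -> zvec w -> zi (herm v w).
Proof. by move=> zv zw; rewrite hermE; solve_zi. Qed.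

Lemma zvec_cross v w : zvec v -> zvec w -> zvec (cross v w).
Proof. by move=> zv zw; apply: zvec_col3; solve_zi. Qed.

Lemma primitive_multiple v : zvec v -> v != 0 -> exists g w,
  [/\ zi g, g != 0, zvec w, primitive w & v = g *: w].
Proof.
move=> zv v0.
have [g1 [x [y [a [b [[zx zy za zb] [g1E aE bE]]]]]]] := zi_bezout hd (zv i0 ord0) (zv i1 ord0).
have zg1 : zi g1 by rewrite g1E; solve_zi.
have [g [z [t [c1 [c [[zz zt zc1 zc] [gE c1E cE]]]]]]] := zi_bezout hd zg1 (zv i2 ord0).
have zg : zi g by rewrite gE; solve_zi.
have vE : v = g *: col3 (a * c1) (b * c1) c.
  by apply: colvecP; rewrite !mxE /= ?aE ?bE ?c1E ?cE; ring.
have g0 : g != 0 by apply: contraNneq v0 => g0; rewrite vE g0 scale0r.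
exists g, (col3 (a * c1) (b * c1) c); split=> //; first by apply: zvec_col3; solve_zi.
(* The Bezout coefficients appear conjugated and in reverse order because [herm] pairs entry [i]
   with the conjugate of entry [2 - i]. *)
exists (col3 (t^*) ((z * y)^*) ((z * x)^*)); first by apply: zvec_col3; solve_zi.
rewrite herm_conj -[RHS](conjC1 C) hermE !mxE /= !conjCK; congr (_^*).
apply: (mulfI g0); rewrite mulr1 [RHS]gE c1E.
have -> : t * (v i2 ord0) = t * (c * g) by rewrite cE.
have e1 : c1 * g = x * (a * (c1 * g)) + y * (b * (c1 * g)) by rewrite -c1E -aE -bE.
rewrite [in RHS]e1; ring.
Qed.

Lemma zvec_w1 : zvec (w1 R).
Proof. by apply: zvec_col3; solve_zi. Qed.
Lemma zvec_w2 : zvec (w2 R).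
Proof. by apply: zvec_col3; solve_zi. Qed.
Lemma herm_w1 : herm (w1 R) (w1 R) = 1.
Proof. by rewrite hermE !mxE /=; conj_ring. Qed.
Lemma herm_w2 : herm (w2 R) (w2 R) = 2.
Proof. by rewrite hermE !mxE /=; conj_ring. Qed.
Lemma primitive_w1 : primitive (w1 R).
Proof. by exists (w1 R); [exact: zvec_w1 | exact: herm_w1]. Qed.
Lemma primitive_w2 : primitive (w2 R).
Proof.
exists (col3 1 0 0); first by apply: zvec_col3; solve_zi.
by rewrite hermE !mxE /=; conj_ring.
Qed.

Lemma perp_nonzero w : zvec w -> herm w w != 0 ->
  exists u, [/\ zvec u, u != 0 & herm u w = 0].
Proof.
move=> zw ww; exists (col3 (w i1 ord0)^* (- (w i2 ord0)^*) 0); split.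
- by apply: zvec_col3; solve_zi.
- apply: contraNneq ww => u0; rewrite hermE.
  have -> : w i1 ord0 = 0.
    by move/colP/(_ i0)/eqP: u0; rewrite !mxE /= conjC_eq0 => /eqP.
  have -> : w i2 ord0 = 0.
    by move/colP/(_ i1)/eqP: u0; rewrite !mxE /= oppr_eq0 conjC_eq0 => /eqP.
  by rewrite rmorph0 !(mulr0, mul0r) !addr0.
- by rewrite hermE !mxE /=; ring.
Qed.

(* [cross u w] is orthogonal to [u], of norm [- <u, u>], so [u + cross u w] is isotropic. *)
Lemma isotropic_in_perp w : zvec w -> herm w w = 1 ->
  exists v, [/\ zvec v, primitive v, herm v v = 0 & herm v w = 0].
Proof.
move=> zw ww.
suff [v [zv v0 vv vw]] : exists v, [/\ zvec v, v != 0, herm v v = 0 & herm v w = 0].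
  have [g [v' [zg g0 zv' pv' vE]]] := primitive_multiple zv v0.
  have g0' : g^* != 0 by rewrite conjC_eq0.
  exists v'; split=> //.
    by apply: (mulfI g0'); apply: (mulfI g0); rewrite !mulr0 -hermZr -hermZl -vE.
  by apply: (mulfI g0); rewrite mulr0 -hermZl -vE.
have ww0 : herm w w != 0 by rewrite ww oner_eq0.
have [u [zu u0 uw]] := perp_nonzero zw ww0.
have [uu|uu] := eqVneq (herm u u) 0; first by exists u.
have uc := herm_cross_l u w.
have cu := herm_perp_sym uc.
exists (u + cross u w); split.
- by apply: zvecD zu (zvec_cross zu zw).
- apply: contraNneq uu => e0.
  have : herm (u + cross u w) u = 0 by rewrite e0 -(scale0r 0) hermZl mul0r.
  by rewrite hermDl cu addr0 => ->.
- rewrite !herm_lin uc cu herm_cross_cross uw ww; ring.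
- by rewrite hermDl uw (herm_perp_sym (herm_cross_r u w)) addr0.
Qed.

Lemma norm1_orbit w : zvec w -> herm w w = 1 ->
  exists A, [/\ unitaryJ A, zvec A & A *m w1 R = w].
Proof.
move=> zw ww; have [v [zv [m zm mv] vv vw]] := isotropic_in_perp zw ww.
pose m1 := m - herm m w *: w.
have zm1 : zvec m1 by apply: zvecD zm (zvecN (zvecZ (zi_herm zm zw) zw)).
have wv := herm_perp_sym vw.
have m1w : herm m1 w = 0 by rewrite !herm_lin ww mulr1 subrr.
have m1v : herm m1 v = 1 by rewrite !herm_lin wv mv mulr0 subr0.
have vm1 : herm v m1 = 1 by rewrite herm_conj m1v rmorph1.
have wm1 := herm_perp_sym m1w.
(* Subtracting [tau * <m1, m1>] times [v] lowers the norm by [(tau + tau^* ) <m1, m1> = <m1, m1>],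
   so [m2] is isotropic. *)
clearbody m1; pose m2 := m1 - (tau * herm m1 m1) *: v.
have zm2 : zvec m2.
  exact: (zvecD zm1 (zvecN (zvecZ (ziM hd (zi_tau _ _) (zi_herm zm1 zm1)) zv))).
have m1r : (herm m1 m1)^* = herm m1 m1 by rewrite -herm_conj.
have m2m2 : herm m2 m2 = 0.
  by rewrite !herm_lin m1v vm1 vv rmorphM /= m1r tau_conj; ring.
have vm2 : herm v m2 = 1 by rewrite !herm_lin vm1 vv mulr0 subr0.
have wm2 : herm w m2 = 0 by rewrite !herm_lin wm1 wv mulr0 subr0.
exists (cols3 v w m2); split.
- exact: unitaryJ_cols3.
- exact: zvec_cols3.
- by rewrite cols3_mul !mxE /= !scale0r scale1r add0r addr0.
Qed.

(* A basis of the orthogonal complement has Gram determinant [-2], and any such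
   form represents 1. *)
Lemma norm1_perp_norm2 w : zvec w -> herm w w = 2 ->
  exists v, [/\ zvec v, herm v v = 1 & herm v w = 0].
Proof.
move=> zw ww.
set a := w i0 ord0; set b := w i1 ord0; set c := w i2 ord0.
have za : zi a by exact: zw.
have zb : zi b^* by apply: zi_conj; exact: zw.
have zc : zi c^* by apply: zi_conj; exact: zw.
have [g [be [al [B' [C' [[zbe zal zB zC] [gE bE cE]]]]]]] := zi_bezout hd zb zc.
have zg : zi g by rewrite gE; solve_zi.
have g0 : g != 0.
  apply/eqP => g0; move: ww; rewrite hermE -/a -/b -/c cE bE g0 !mulr0.
  rewrite -(conjCK c) cE g0 mulr0 rmorph0 mul0r !addr0 => /esym/eqP.
  by rewrite pnatr_eq0.
have bez : be * B' + al * C' = 1 by apply: (mulIf g0); rewrite mul1r [RHS]gE bE cE; ring.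
(* The Bezout coefficients are placed so that [cross p q = - w]; by [herm_cross_cross] the Gram
   determinant of [p], [q] is then [- <w, w> = -2]. *)
pose p := col3 B' (- C') 0; pose q := col3 (- (a^* * al)) (- (a^* * be)) g.
have zp : zvec p by apply: zvec_col3; solve_zi.
have zq : zvec q by apply: zvec_col3; solve_zi.
have pw : herm p w = 0 by rewrite hermE !mxE /= -/b -/c -/a bE cE; ring.
have qw : herm q w = 0 by rewrite hermE !mxE /= -/b -/c -/a [g in _ + g * _]gE; ring.
have pqw : cross p q = - w.
  apply: colvecP; rewrite !mxE /= -/a -/b -/c.
  - transitivity (- (a^* * (be * B' + al * C'))^*); first by conj_ring.
    by rewrite bez mulr1 conjCK.
  - by rewrite -(conjCK b) bE; conj_ring.
  - by rewrite -(conjCK c) cE; conj_ring.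
have ppr : (herm p p)^* = herm p p by rewrite -herm_conj.
have qqr : (herm q q)^* = herm q q by rewrite -herm_conj.
have [P hP] := zi_real hd (zi_herm zp zp) ppr.
have [Q hQ] := zi_real hd (zi_herm zq zq) qqr.
have det : (P%:~R * Q%:~R - herm p q * (herm p q)^* : C) = - 2.
  have := herm_cross_cross p q; rewrite pqw !herm_lin ww hP hQ opprK => ->.
  by rewrite -herm_conj; ring.
have [x [y [zx zy f1]]] := bform_rep1 hd (zi_herm zp zq) det.
exists (x *: p + y *: q); split.
- by apply: zvecD; apply: zvecZ.
- by rewrite -f1 /bform -hP -hQ -(herm_conj p q) !herm_lin; ring.
- by rewrite !herm_lin pw qw !mulr0 addr0.
Qed.

End IntegralVectors.

(** * Gluing modulo 2 and the orbit of norm 2 *)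

Lemma int_parity (m : int) : exists e : int, m = 2 * e \/ m = 2 * e + 1.
Proof. by exists (m %/ 2)%Z; lia. Qed.

(* Two vectors that are linearly dependent mod 2 lie on a common line of F_2^2. *)
Lemma dependent_mod2 (m n p q s : int) : n * p - m * q = 2 * s ->
  [\/ exists n' q' : int, n = 2 * n' /\ q = 2 * q',
      exists n' q' : int, n = 2 * n' - m /\ q = 2 * q' - p |
      exists m' p' : int, m = 2 * m' /\ p = 2 * p'].
Proof.
have [m' hm] := int_parity m; have [n' hn] := int_parity n.
have [p' hp] := int_parity p; have [q' hq] := int_parity q.
case: hm => ->; case: hn => ->; case: hp => ->; case: hq => -> h;
  by [constructor 1; exists n', q'; split
     |constructor 3; exists m', p'; split
     |constructor 2; exists (n' + m'), (q' + p'); split; ring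
     |constructor 2; exists (n' + m' + 1), (q' + p'); split; ring
     |constructor 2; exists (n' + m'), (q' + p' + 1); split; ring
     |constructor 2; exists (n' + m' + 1), (q' + p' + 1); split; ring
     |exfalso; lia].
Qed.

Section NormTwo.
Variables (R : realType) (d : nat).
Local Notation C := R[i].
Local Notation zi := (@zi R d).
Local Notation tau := (@tau R d).
Hypothesis hd : d \in [:: 7; 11; 19]%N.
Implicit Types (u v w x : 'cV[C]_3) (A B : 'M[C]_3).

Lemma tau_mul_conj : tau * (1 - tau) = (kd d)%:R.
Proof. by rewrite mulrBr mulr1 -expr2 tau_sqr //; ring. Qed.

Lemma tau_sqr_sub : tau ^+ 2 - tau + (kd d)%:R = 0.
Proof. by rewrite tau_sqr //; ring. Qed.

(** Here [tau] and [1 - tau] have norm 2, so an inverse would have norm 1/2. *)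
Lemma no_tau_divisor z : kd d = 2 -> zi z -> tau * z = 1 \/ (1 - tau) * z = 1 -> False.
Proof.
move=> k2 zz h; apply: (zi_norm_half hd zz).
have <- : tau * (1 - tau) = 2 :> C by rewrite tau_mul_conj k2.
case: h => h.
  transitivity ((tau * z) * (tau * z)^*); last by rewrite h rmorph1 mulr1.
  by rewrite rmorphM /= tau_conj; ring.
transitivity (((1 - tau) * z) * ((1 - tau) * z)^*); last by rewrite h rmorph1 mulr1.
by rewrite rmorphM rmorphB rmorph1 /= tau_conj; ring.
Qed.

(** When 2 is inert, [tau] generates the units of O/2. This lifts it to the entry [x] of an isometry
    of diag(1, -2): the norms are 3 = 1 + 2 * 1 for [d = 11] and 11 = 1 + 2 * 5 for [d = 19]. *)
Lemma odd_norm : kd d != 2 -> exists (j : nat) (e : int) (y : C),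
  [/\ kd d = (2 * j + 1)%N, zi y & (tau + 2 * e%:~R) * (tau + 2 * e%:~R)^* - 2 * (y * y^*) = 1].
Proof.
have E (e : int) : (tau + 2 * e%:~R) * (tau + 2 * e%:~R)^* = (kd d)%:R + 2 * e%:~R + 4 * e%:~R ^+ 2 :> C.
  rewrite -tau_mul_conj !(rmorphD, rmorphM, rmorph_int, rmorph_nat) /= tau_conj; ring.
case: (kd_cases hd) => k; rewrite k // => _.
  exists 1, 0, 1; split; solve_zi; rewrite E k; conj_ring.
exists 2, 1, tau; split; solve_zi; rewrite E tau_conj tau_mul_conj k; ring.
Qed.

(* The isometries of the complement of [w] realise every gluing of the
   discriminant modules O/2. *)
Lemma norm2_glue (a c : C) : zi a -> zi c -> a * c^* + c * a^* = 2 ->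
  (exists s t, [/\ zi s, zi t & s * a^* + t * c^* = 1]) ->
  exists x y : C, [/\ zi x, zi y, x * x^* - 2 * (y * y^*) = 1,
    zi ((a + x^* * a^*) / 2) & zi ((c + x^* * c^*) / 2)].
Proof.
move=> za zc tr [s [t [zs zt st]]].
have [m [n aE]] := za; have [p [q cE]] := zc.
have aC : a^* = m%:~R + n%:~R * (1 - tau) by rewrite aE !(rmorphD, rmorphM, rmorph_int) /= tau_conj.
have cC : c^* = p%:~R + q%:~R * (1 - tau) by rewrite cE !(rmorphD, rmorphM, rmorph_int) /= tau_conj.
set k := kd d.
have : n * p - m * q = 2 * (1 - m * (p + q) - k%:Z * n * q).
  have kE : (k%:~R : C) = tau * (1 - tau) by rewrite tau_mul_conj.
  apply: (@intr_inj C).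
  apply: subr0_eq; transitivity (a * c^* + c * a^* - 2); last by rewrite tr subrr.
  by rewrite !(rmorphD, rmorphN, rmorphM) /= kE aC cC aE cE rmorph1; ring.
have halve (e : C) z : zi e -> z = 2 * e -> zi (z / 2).
  by move=> ze ->; rewrite mulrAC divff ?mul1r // pnatr_eq0.
(* Modulo 2, [a] and [c] are both integer multiples of 1, of [1 + tau] or of [tau]; the required
   [x^*] is congruent to 1, [tau] or [tau^*] respectively. For [k = 2] the last two cases cannot
   occur, since [tau] or [1 - tau] would divide both [a^*] and [c^*], against [st]. *)
case/dependent_mod2 => [[n' [q' [nE qE]]]|[n' [q' [nE qE]]]|[m' [p' [mE pE]]]].
- exists 1, 0; split; solve_zi; first by conj_ring.
    apply: (halve (m + n')%:~R); solve_zi.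
    by rewrite rmorph1 mul1r aC aE nE !(rmorphD, rmorphM) /=; ring.
  apply: (halve (p + q')%:~R); solve_zi.
  by rewrite rmorph1 mul1r cC cE qE !(rmorphD, rmorphM) /=; ring.
- have aC' : a^* = (2 * n')%:~R - n%:~R * tau by rewrite aC nE !(rmorphB, rmorphM) /=; ring.
  have cC' : c^* = (2 * q')%:~R - q%:~R * tau by rewrite cC qE !(rmorphB, rmorphM) /=; ring.
  have [k2|kodd] := eqVneq k 2.
    have t2 : 2 = tau * (1 - tau) :> C by rewrite tau_mul_conj -/k k2.
    case: (no_tau_divisor k2 (z := s * (n'%:~R * (1 - tau) - n%:~R) + t * (q'%:~R * (1 - tau) - q%:~R))).
      by solve_zi; apply: ziD; solve_zi.
    left; rewrite -[RHS]st aC' cC' !rmorphM /= rmorph_nat t2; ring.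
  have [j [e [y [kj zy ey]]]] := odd_norm kodd.
  have k2j : (k%:R : C) = 2 * j%:R + 1 by rewrite /k kj natrD natrM.
  have key b (m0 n0 n1 : int) : zi b -> b = m0%:~R + n0%:~R * tau ->
      b^* = (2 * n1)%:~R - n0%:~R * tau -> n0 = 2 * n1 - m0 -> zi ((b + (tau + 2 * e%:~R) * b^*) / 2).
    move=> zb bE bC n0E.
    apply: (halve (n1%:~R * k%:R - m0%:~R * j%:R + n1%:~R * tau + e%:~R * b^*)); solve_zi.
    apply: subr0_eq; transitivity (- n0%:~R * (tau ^+ 2 - tau + k%:R)); last first.
      by rewrite tau_sqr_sub mulr0.
    by rewrite bC bE n0E k2j !(rmorphB, rmorphM) /=; ring.
  exists (tau + 2 * e%:~R)^*, y; rewrite conjCK; split; solve_zi.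
  - by rewrite mulrC.
  - exact: (key _ _ _ _ za aE aC' nE).
  - exact: (key _ _ _ _ zc cE cC' qE).
- have aC' : a^* = (2 * m')%:~R + n%:~R * (1 - tau) by rewrite aC mE.
  have cC' : c^* = (2 * p')%:~R + q%:~R * (1 - tau) by rewrite cC pE.
  have [k2|kodd] := eqVneq k 2.
    have t2 : 2 = tau * (1 - tau) :> C by rewrite tau_mul_conj -/k k2.
    case: (no_tau_divisor k2 (z := s * (m'%:~R * tau + n%:~R) + t * (p'%:~R * tau + q%:~R))).
      by solve_zi.
    right; rewrite -[RHS]st aC' cC' !rmorphM /= rmorph_nat t2; ring.
  have [j [e [y [kj zy ey]]]] := odd_norm kodd.
  have k2j : (k%:R : C) = 2 * j%:R + 1 by rewrite /k kj natrD natrM.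
  have key b (m0 n0 m1 : int) : zi b -> b = m0%:~R + n0%:~R * tau ->
      b^* = (2 * m1)%:~R + n0%:~R * (1 - tau) -> m0 = 2 * m1 ->
      zi ((b + (tau + 2 * e%:~R)^* * b^*) / 2).
    move=> zb bE bC m0E.
    apply: (halve (- (j%:R * n0%:~R) + (2 * m1)%:~R - m1%:~R * tau + e%:~R * b^*)); solve_zi.
    apply: subr0_eq; transitivity (n0%:~R * (tau ^+ 2 - tau + k%:R)); last first.
      by rewrite tau_sqr_sub mulr0.
    rewrite bC bE m0E k2j !(rmorphD, rmorphM, rmorph_int, rmorph_nat) /= tau_conj; ring.
  exists (tau + 2 * e%:~R), y; split; solve_zi.
  - exact: (key _ _ _ _ za aE aC' mE).
  - exact: (key _ _ _ _ zc cE cC' pE).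
Qed.

Lemma norm2_orbit_perp_w1 w : zvec d w -> primitive d w -> herm w w = 2 -> w i1 ord0 = 0 ->
  exists A, [/\ unitaryJ A, zvec d A & A *m w2 R = w].
Proof.
move=> zw [z zz zw1] ww w1.
set a := w i0 ord0; set c := w i2 ord0.
have za : zi a by exact: zw.
have zc : zi c by exact: zw.
have D : a * c^* + c * a^* = 2.
  by rewrite -ww hermE w1 mul0r addr0.
have bez : exists s t, [/\ zi s, zi t & s * a^* + t * c^* = 1].
  exists (z i2 ord0), (z i0 ord0); split; [exact: zz|exact: zz|].
  by rewrite -zw1 hermE w1 rmorph0 mulr0 addr0 addrC.
have [x [y [zx zy E ze zf]]] := norm2_glue za zc D bez.
set e := (a + _) / 2 in ze; set f := (c + _) / 2 in zf.
have E' : x * x^* = 1 + 2 * (y * y^*) by apply/eqP; rewrite -subr_eq E.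
(* Put [u = (a^*, 0, - c^* )], of norm -2 and orthogonal to [w] and [w1]. The matrix sends [w2] to
   [w], [w1] to [x w1 + y u], and [(1, 0, -1)] to [2 y^* w1 + x^* u]. Its outer columns are half the
   sum and half the difference of two of these images, whence the integrality conditions on [e] and
   [f]. *)
exists (cols3 (col3 e y^* (c - f)) (col3 (y * a^*) x (- (y * c^*))) (col3 (a - e) (- y^*) f)).
split.
- apply: unitaryJ_cols3; rewrite hermE !mxE /= /e /f.
  + transitivity ((a * c^* + c * a^*) * (1 - x * x^*) / 4 + y * y^*); first by conj_field.
    by rewrite D E'; field.
  + transitivity (x * x^* - (y * y^*) * (a * c^* + c * a^*)); first by conj_field.
    by rewrite D E'; field.
  + transitivity ((a * c^* + c * a^*) * (1 - x * x^*) / 4 + y * y^*); first by conj_field.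
    by rewrite D E'; field.
  + transitivity (y^* * x^* * (1 - (a * c^* + c * a^*) / 2)); first by conj_field.
    by rewrite D; field.
  + transitivity ((a * c^* + c * a^*) * (1 + x * x^*) / 4 - y * y^*); first by conj_field.
    by rewrite D E'; field.
  + transitivity (y * x * ((a * c^* + c * a^*) / 2 - 1)); first by conj_field.
    by rewrite D; field.
- by apply: zvec_cols3; apply: zvec_col3; solve_zi.
- rewrite cols3_mul; apply: colvecP; rewrite !mxE /= -/a -/c ?w1; ring.
Qed.

Lemma norm2_orbit w : zvec d w -> primitive d w -> herm w w = 2 ->
  exists A, [/\ unitaryJ A, zvec d A & A *m w2 R = w].
Proof.
move=> zw [z zz zw1] ww.
have [v [zv vv vw]] := norm1_perp_norm2 hd zw ww.
have [A [uA zA Av]] := norm1_orbit hd zv vv.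
have uA' := unitaryJV uA; have zA' := zvec_inv hd uA zA.
have iA : A \in unitmx by case/andP: uA.
have [||||B [uB zB BW]] := @norm2_orbit_perp_w1 (invmx A *m w).
- exact: zvecM.
- exists (invmx A *m z); first exact: zvecM.
  by rewrite herm_unitary.
- by rewrite herm_unitary.
- have : herm (invmx A *m w) (w1 R) = 0.
    by rewrite -(herm_unitary _ _ uA) mulmxA mulmxV // mul1mx Av herm_conj vw rmorph0.
  by rewrite hermE !mxE /= !rmorph0 rmorph1 !mulr0 add0r addr0 mulr1.
exists (A *m B); split.
- exact: unitaryJM.
- exact: zvecM.
- by rewrite -mulmxA BW mulmxA mulmxV // mul1mx.
Qed.

End NormTwo.

(** * Identification of Z + Z [tau] with the ring of integers *)

Section RingOfIntegers.
Variables (R : realType) (d : nat).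
Local Notation C := R[i].
Local Notation zi := (@zi R d).
Local Notation tau := (@tau R d).
Local Notation integral := (integralOver (intr : int -> C)).
Hypothesis hd : d \in [:: 7; 11; 19]%N.

Lemma integral_intr (m : int) : integral m%:~R.
Proof. exact: (integral_id (intr : int -> C) m). Qed.

Lemma integral_tau : integral tau.
Proof.
exists ('X * ('X - 1%:P) + (kd d)%:Z%:P).
  rewrite monicE lead_coefDl ?lead_coef_Mmonic ?monicXsubC ?lead_coefX //.
  by rewrite size_monicM ?monicX ?polyXsubC_eq0 // size_polyX size_XsubC size_polyC; case: (_ != _).
rewrite rootE !(rmorphD, rmorphN, rmorphM) /= !map_polyC map_polyX /=.
rewrite !hornerE.
have := tau_sqr_sub R hd; rewrite -[(kd d)%:~R]/((kd d)%:R : C) => h.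
by apply/eqP; rewrite -[RHS]h; ring.
Qed.

Lemma integral_conj (z : C) : integral z -> integral z^*.
Proof.
case=> p p_monic p_root; exists p => //.
have -> : map_poly (intr : int -> C) p = map_poly Num.conj (map_poly intr p).
  by rewrite -map_poly_comp; apply: eq_map_poly => x /=; rewrite rmorph_int.
by rewrite fmorph_root.
Qed.

Lemma ring_of_integersP (z : C) : ring_of_integers d z <-> zi z.
Proof.
split.
- have : [/\ delta R d = 2 * tau - 1, delta R d * delta R d = - d%:R, (delta R d)^* = - delta R d & integral (delta R d)].
    split; [exact: delta_tau | by rewrite -expr2 delta_sqr | exact: delta_conj |].
    rewrite delta_tau; apply: integral_sub; last exact: (integral_intr 1).
    by apply: integral_mul integral_tau; exact: (integral_intr 2).
  move=> h [[a [b zE]] iz]; move: h zE; rewrite -/(delta R d).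
  move: (delta R d) => D [dE dd dC id] zE.
  have izc := integral_conj iz.
  have conj_ratr (q : rat) : (ratr q : C)^* = ratr q by apply: conj_Creal; rewrite realE ler0q lerq0 -realE num_real.
  have zcE : z^* = ratr a - ratr b * D.
    by rewrite zE rmorphD /= conj_ratr rmorphM /= conj_ratr dC mulrN.
  have [t tE] : exists t : int, 2 * a = t%:~R.
    apply: (@integral_ratr_int C).
    have -> : ratr (2 * a) = z + z^* by rewrite zcE zE rmorphM /= rmorph_nat; ring.
    exact: integral_add.
  have [N NE] : exists N : int, a ^+ 2 + d%:R * b ^+ 2 = N%:~R.
    apply: (@integral_ratr_int C).
    have -> : ratr (a ^+ 2 + d%:R * b ^+ 2) = z * z^*.
      rewrite zcE zE !(rmorphD, rmorphM, rmorphXn, rmorph_nat) /=.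
      transitivity (ratr a ^+ 2 - ratr b ^+ 2 * (D * D)); last by ring.
      by rewrite dd; ring.
    exact: integral_mul.
  (* Multiplying [z - z^* = 2 b D] by [D] makes it rational at the cost of a factor [d], which is
     removed below because [d] is prime and divides [e ^+ 2]. *)
  have [e eE] : exists e : int, d%:R * (2 * b) = e%:~R.
    apply: (@integral_ratr_int C).
    have -> : ratr (d%:R * (2 * b)) = - ((z - z^*) * D).
      rewrite zcE zE !(rmorphM, rmorph_nat) /=.
      transitivity (- (2 * ratr b * (D * D))); last by ring.
      by rewrite dd; ring.
    by apply: integral_opp; apply: integral_mul => //; apply: integral_sub.
  have eq1 : e ^+ 2 = d%:Z * (4 * N - t ^+ 2).
    apply: (@intr_inj rat); rewrite !(rmorphM, rmorphB, rmorphXn) /= -eE -NE -tE.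
    by rewrite -[d%:~R]/(d%:R : rat); ring.
  have [s sE] : exists s : int, e = d%:Z * s.
    have prd : prime d by move: hd; rewrite !inE => /or3P[] /eqP->.
    have : (d%:Z %| e ^+ 2)%Z by rewrite eq1 dvdz_mulr.
    rewrite expr2 dvdzE abszM Euclid_dvdM // orbb => /dvdnP[q qE].
    have : (d%:Z %| e)%Z by rewrite dvdzE /= qE dvdn_mull.
    by case/dvdzP => s ->; exists s; rewrite mulrC.
  have d0 : (0 < d)%N by move: hd; rewrite !inE => /or3P[] /eqP->.
  have bs : 2 * b = s%:~R.
    have d0' : (d%:R : rat) != 0 by rewrite pnatr_eq0 -lt0n.
    by apply: (mulfI d0'); rewrite eE sE rmorphM.
  (* As [d] is -1 modulo 4, [s^2] and [t^2] agree modulo 4, hence [s] and [t] have the same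
     parity. *)
  have par : exists h : int, t = 2 * h + s.
    have : d%:Z * s ^+ 2 = 4 * N - t ^+ 2.
      apply: (@mulfI _ d%:Z); first by lia.
      by rewrite -eq1 sE; ring.
    have [t' tP] := int_parity t; have [s' sP] := int_parity s.
    have [k dk] : exists k : int, d%:Z = 4 * k - 1 by exists (kd d); have := kdP hd; lia.
    rewrite dk; case: tP => ->; case: sP => -> h.
    + by exists (t' - s'); ring.
    + by exfalso; lia.
    + by exfalso; lia.
    + by exists (t' - s'); ring.
  have [h hE] := par; exists h, s.
  apply: (@mulfI _ (2 : C)); first by rewrite pnatr_eq0.
  have ra : 2 * ratr a = t%:~R :> C by rewrite -[2](rmorph_nat (ratr : rat -> C)) -rmorphM /= tE ratr_int.
  have rb : 2 * ratr b = s%:~R :> C by rewrite -[2](rmorph_nat (ratr : rat -> C)) -rmorphM /= bs ratr_int.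
  transitivity (2 * ratr a + 2 * ratr b * D); first by rewrite zE; ring.
  by rewrite ra rb hE dE rmorphD rmorphM /= rmorph_nat; ring.
case=> m [n zE]; split.
- exists (m%:~R + n%:~R / 2), (n%:~R / 2); rewrite -/(delta R d) zE delta_tau.
  by rewrite rmorphD /= !fmorph_div /= !ratr_int ?ratr_nat; field.
- rewrite zE; apply: integral_add; first exact: integral_intr.
  by apply: integral_mul integral_tau; exact: integral_intr.
Qed.

End RingOfIntegers.

(** * Mirrors, their polar vectors and their fixers *)

Section Mirrors.
Local Open Scope classical_set_scope.
Local Open Scope quotient_scope.
Variable R : realType.
Local Notation C := R[i].
Implicit Types (u v w x n : 'cV[C]_3) (A B : 'M[C]_3).

Lemma herm_real v : (herm v v)^* = herm v v.
Proof. by rewrite -herm_conj. Qed.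

Lemma herm_nondegenerate u v : (forall x, herm x u = herm x v) -> u = v.
Proof.
move=> h; apply: colvecP; apply: (can_inj (@conjCK C)).
- by have := h (col3 0 0 1); rewrite !hermE !mxE /= !mul0r !add0r !mul1r.
- by have := h (col3 0 1 0); rewrite !hermE !mxE /= !mul0r !add0r !mul1r !addr0.
- by have := h (col3 1 0 0); rewrite !hermE !mxE /= !mul0r !mul1r !addr0.
Qed.

Lemma line_scale v w : <[v]>%VS = <[w]>%VS -> exists c : C, v = c *: w.
Proof. by move=> h; apply/vlineP; rewrite -h memv_line. Qed.

Lemma mirror_line v w : herm v v < 0 -> herm v w = 0 -> mirror w <[v]>%VS.
Proof. by move=> vv vw; split; exists v. Qed.

Lemma mirrorP w L : mirror w L -> exists v, [/\ herm v v < 0, herm v w = 0 & L = <[v]>%VS].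
Proof.
case=> [[v vv <-] [v' v'w hv]]; exists v; split=> //.
by have [c ->] := line_scale (esym hv); rewrite hermZl v'w mulr0.
Qed.

Lemma mirror_scale c w : c != 0 -> mirror (c *: w) = mirror w.
Proof.
move=> c0; apply/seteqP; split=> L /mirrorP[v [vv vw ->]]; apply: mirror_line => //.
  by move/eqP: vw; rewrite hermZr mulf_eq0 conjC_eq0 (negPf c0) => /eqP.
by rewrite hermZr vw mulr0.
Qed.

Lemma act_mirror (A : UJ R) w : act (\pi_(PU R) A) @` mirror w = mirror (UJval A *m w).
Proof.
have uA := UJvalP A; have iA := UJ_unit A.
apply/seteqP; split=> L.
  case=> L' /mirrorP[v [vv vw ->]] <-; rewrite act_pi.
  by apply: mirror_line; rewrite herm_unitary.
move=> /mirrorP[v [vv vw ->]]; exists <[invmx (UJval A) *m v]>%VS.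
  by apply: mirror_line; rewrite -(herm_unitary _ _ uA) !mulmxA mulmxV // !mul1mx.
by rewrite act_pi mulmxA mulmxV // mul1mx.
Qed.

Lemma act_fix_eigen (A : UJ R) v : act (\pi_(PU R) A) <[v]>%VS = <[v]>%VS ->
  exists c, UJval A *m v = c *: v.
Proof. by rewrite act_pi => /line_scale. Qed.

(* The orthogonal projections to [w^perp] of a basis of negative vectors are
   negative and span [w^perp]. *)
Definition perp_proj w n := n - (herm n w / herm w w) *: w.

Lemma perp_proj_perp w n : 0 < herm w w -> herm (perp_proj w n) w = 0.
Proof. by move=> /gt_eqF/negbT ww; rewrite /perp_proj !herm_lin divfK // subrr. Qed.

Lemma perp_proj_neg w n : 0 < herm w w -> herm n n < 0 ->
  herm (perp_proj w n) (perp_proj w n) < 0.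
Proof.
move=> ww nn; have ww0 : herm w w != 0 by rewrite gt_eqF.
have -> : herm (perp_proj w n) (perp_proj w n)
    = herm n n - herm n w * (herm n w)^* / herm w w.
  rewrite {2}/perp_proj hermDr hermNr hermZr perp_proj_perp // mulr0 subr0.
  by rewrite /perp_proj !herm_lin (herm_conj n w); ring.
rewrite subr_lt0; apply: lt_le_trans nn _.
by apply: divr_ge0; [exact: mul_conjC_ge0 | exact: ltW].
Qed.

Lemma neg_basis (m : nat) (F : 'M[C]_(m, 3)) :
  F *m col3 1 0 (-1) = 0 -> F *m col3 1 0 (-2) = 0 -> F *m col3 1 1 (-1) = 0 ->
  forall x, F *m x = 0.
Proof.
move=> h1 h2 h3 x.
have -> : x = (2 * x i0 ord0 - x i1 ord0 + x i2 ord0) *: col3 1 0 (-1)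
    + (- (x i0 ord0 + x i2 ord0)) *: col3 1 0 (-2) + x i1 ord0 *: col3 1 1 (-1).
  by apply: colvecP; rewrite !mxE /=; ring.
by rewrite !mulmxDr -!scalemxAr h1 h2 h3 !scaler0 !addr0.
Qed.

Lemma neg_basis_neg :
  [/\ herm (col3 1 0 (-1)) (col3 1 0 (-1)) < 0 :> C,
      herm (col3 1 0 (-2)) (col3 1 0 (-2)) < 0 :> C &
      herm (col3 1 1 (-1)) (col3 1 1 (-1)) < 0 :> C].
Proof.
split.
- have -> : herm (col3 1 0 (-1)) (col3 1 0 (-1)) = - 2 :> C.
    by rewrite hermE !mxE /=; conj_ring.
  by rewrite oppr_lt0 ltr0n.
- have -> : herm (col3 1 0 (-2)) (col3 1 0 (-2)) = - 4 :> C.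
    by rewrite hermE !mxE /=; conj_ring.
  by rewrite oppr_lt0 ltr0n.
have -> : herm (col3 1 1 (-1)) (col3 1 1 (-1)) = - 1 :> C.
  by rewrite hermE !mxE /=; conj_ring.
by rewrite oppr_lt0 ltr01.
Qed.

(** A linear map that vanishes on the negative vectors of [w^perp] vanishes on [w^perp], so it only
    sees the component along [w]. The number of rows is free because [F] is either [A - a] or a
    single row representing a functional. *)
Lemma perp_span (m : nat) (F : 'M[C]_(m, 3)) w : 0 < herm w w ->
  (forall n, herm n n < 0 -> herm n w = 0 -> F *m n = 0) ->
  forall x, F *m x = (herm x w / herm w w) *: (F *m w).
Proof.
move=> ww h x.
pose P : 'M[C]_3 := 1%:M - (herm w w)^-1 *: (w *m (ctrmx w *m J R)).
have PE y : P *m y = perp_proj w y.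
  rewrite mulmxBl mul1mx -scalemxAl -!mulmxA (mulmxA (ctrmx w)).
  by rewrite herm_rowE mul_mx_scalar scalerA mulrC.
have [n1 n2 n3] := neg_basis_neg.
have := @neg_basis _ (F *m P) _ _ _ x.
rewrite -!mulmxA !PE => E; apply/eqP; rewrite -subr_eq0; apply/eqP.
rewrite scalemxAr -mulmxBr; apply: E; apply: h;
  solve [exact: perp_proj_perp | exact: perp_proj_neg].
Qed.

(** Otherwise [u], [v], [w] would be orthogonal with positive Gram determinant, whereas [gram_det]
    makes it nonpositive. *)
Lemma neg_perp_pairing u v w : 0 < herm w w -> herm u u < 0 -> herm v v < 0 ->
  herm u w = 0 -> herm v w = 0 -> herm u v != 0.
Proof.
move=> ww uu vv uw vw; apply/eqP => uv.
have := gram_det u v w; rewrite uw (herm_perp_sym uw) (herm_perp_sym vw) uv !mul0r !subr0 addr0 => h.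
have : 0 < herm w w * (herm u u * herm v v) by rewrite pmulr_rgt0 // nmulr_rgt0.
by rewrite h oppr_gt0 => /lt_geF; rewrite mul_conjC_ge0.
Qed.

(* Two negative vectors of [w^perp], of signature (1,1), are never orthogonal,
   so their eigenvalues under an isometry coincide. *)
Lemma mirror_fixer_form A w : unitaryJ A -> 0 < herm w w ->
  (forall n, herm n n < 0 -> herm n w = 0 -> exists c, A *m n = c *: n) ->
  exists a b, [/\ a * a^* = 1, b * b^* = 1 &
    forall x, A *m x = a *: x + ((b - a) * (herm x w / herm w w)) *: w].
Proof.
move=> uA ww eig.
have ww0 : herm w w != 0 by rewrite gt_eqF.
have [n1 _ _] := neg_basis_neg.
pose n0 := perp_proj w (col3 1 0 (-1)).
have n0w : herm n0 w = 0 by exact: perp_proj_perp.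
have n0n : herm n0 n0 < 0 by exact: perp_proj_neg.
have [a An0] := eig n0 n0n n0w.
have aa : a * a^* = 1.
  have n00 : herm n0 n0 != 0 by rewrite lt_eqF.
  apply: (mulIf n00); rewrite mul1r -{2}(herm_unitary n0 n0 uA) An0 hermZl hermZr; ring.
have Aperp n : herm n n < 0 -> herm n w = 0 -> A *m n = a *: n.
  move=> nn nw; have [c An] := eig n nn nw; rewrite An.
  have nn0 := neg_perp_pairing ww nn n0n nw n0w.
  suff -> : c = a by [].
  have : c * a^* = a * a^*.
    rewrite aa; apply: (mulIf nn0).
    by rewrite mul1r -{2}(herm_unitary n n0 uA) An An0 hermZl hermZr; ring.
  have a0 : a^* != 0 by apply/eqP => a0; move: aa; rewrite a0 mulr0 => /esym/eqP; rewrite oner_eq0.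
  exact: mulIf.
have hA n : herm n n < 0 -> herm n w = 0 -> (A - a%:M) *m n = 0.
  by move=> nn nw; rewrite mulmxBl Aperp // mul_scalar_mx subrr.
have Ax x : A *m x = a *: x + (herm x w / herm w w) *: (A *m w - a *: w).
  have := perp_span ww hA x; rewrite !mulmxBl !mul_scalar_mx => <-.
  by rewrite addrC subrK.
(* [A w] is orthogonal to the negative vectors of [w^perp], since up to the factor [a] they are
   their own images under [A]; this makes it a multiple of [w]. *)
have [b Aw] : exists b, A *m w = b *: w.
  exists (herm w (A *m w) / herm w w)^*.
  apply: herm_nondegenerate => x; rewrite hermZr conjCK.
  have h2 n : herm n n < 0 -> herm n w = 0 -> ctrmx (A *m w) *m J R *m n = 0.
    move=> nn nw; rewrite herm_rowE.
    suff -> : herm n (A *m w) = 0 by apply/matrixP => i j; rewrite !ord1 !mxE.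
    have a0 : a != 0 by apply/eqP => a0; move: aa; rewrite a0 mul0r => /esym/eqP; rewrite oner_eq0.
    by apply: (mulfI a0); rewrite mulr0 -hermZl -(Aperp n nn nw) herm_unitary.
  have := perp_span ww h2 x; rewrite !herm_rowE => /matrixP/(_ ord0 ord0).
  by rewrite !mxE /= !mulr1n => ->; ring.
exists a, b; split=> //.
  by apply: (mulIf ww0); rewrite mul1r -{2}(herm_unitary w w uA) Aw hermZl hermZr; ring.
by move=> x; rewrite Ax Aw -scalerBl scalerA mulrC.
Qed.

Lemma mirror_inj w w' : 0 < herm w w -> 0 < herm w' w' -> mirror w = mirror w' ->
  exists c, w' = c *: w.
Proof.
move=> ww ww' E; exists (herm w w' / herm w w)^*.
apply: herm_nondegenerate => x; rewrite hermZr conjCK.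
have h2 n : herm n n < 0 -> herm n w = 0 -> ctrmx w' *m J R *m n = 0.
  move=> nn nw; rewrite herm_rowE.
  have : mirror w' <[n]>%VS by rewrite -E; apply: mirror_line.
  case/mirrorP => v [_ vw' hv]; have [c ->] := line_scale hv.
  by rewrite hermZl vw' mulr0; apply/matrixP => i j; rewrite !ord1 !mxE mul0rn.
have := perp_span ww h2 x; rewrite !herm_rowE => /matrixP/(_ ord0 ord0).
by rewrite !mxE /= !mulr1n => ->; ring.
Qed.

End Mirrors.

(** * Reflections in [Gamma d] and their mirrors *)

Section Reflections.
Local Open Scope classical_set_scope.
Local Open Scope quotient_scope.
Variables (R : realType) (d : nat).
Local Notation C := R[i].
Local Notation zi := (@zi R d).
Local Notation zvec := (@zvec R d _ _).
Local Notation primitive := (@primitive R d).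
Hypothesis hd : d \in [:: 7; 11; 19]%N.
Implicit Types (u v w x n : 'cV[C]_3) (A B : 'M[C]_3).

Lemma GammaP (g : PU R) : Gamma d g <->
  exists A : UJ R, zvec (UJval A) /\ g = \pi_(PU R) A.
Proof.
split; first by case=> A [iA zA _] <-; exists A; split=> // i j; apply/(ring_of_integersP hd).
case=> A [zA ->]; exists A => //; split; first exact: UJ_unit.
  by move=> i j; apply/(ring_of_integersP hd).
by move=> i j; apply/(ring_of_integersP hd); apply: zvec_inv => //; exact: UJvalP.
Qed.

Lemma primitive_image A w : unitaryJ A -> zvec A -> primitive w -> primitive (A *m w).
Proof.
move=> uA zA [x zx xw]; exists (A *m x); first exact: zvecM.
by rewrite herm_unitary.
Qed.

Lemma primitive_coef v w c : zvec v -> primitive w -> v = c *: w -> zi c.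
Proof.
move=> zv [x zx xw] vE.
have <- : herm v x = c by rewrite vE hermZl herm_conj xw rmorph1 mulr1.
exact: zi_herm.
Qed.

(** Both eigenvalues occur on primitive integral vectors, one in [w^perp] and [w] itself, so
    [primitive_coef] makes them integral; being of norm 1 they are units. *)
Lemma fixer_integral_eigenvalues A w a b : zvec A -> zvec w -> primitive w -> herm w w != 0 ->
  a * a^* = 1 -> b * b^* = 1 ->
  (forall x, A *m x = a *: x + ((b - a) * (herm x w / herm w w)) *: w) ->
  (a = 1 \/ a = -1) /\ (b = 1 \/ b = -1).
Proof.
move=> zA zw pw ww aa bb AE.
have [v [zv v0 vw]] := perp_nonzero zw ww.
have [g [v' [zg g0 zv' pv' vE]]] := primitive_multiple hd zv v0.
have v'w : herm v' w = 0 by apply: (mulfI g0); rewrite mulr0 -hermZl -vE.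
split; apply: (@zi_unit R d) => //.
  apply: (@primitive_coef (A *m v') v') => //; first exact: zvecM.
  by rewrite AE v'w mul0r mulr0 scale0r addr0.
apply: (@primitive_coef (A *m w) w) => //; first exact: zvecM.
by rewrite AE divff // mulr1 -scalerDl addrC subrK.
Qed.

(* A nonzero column of [y (A - a)], with [y] clearing the denominator of [a],
   is an integral multiple of [w]. *)
Lemma fixer_integral_polar A w a b : zvec A -> w != 0 -> herm w w != 0 -> b != a ->
  (forall x, A *m x = a *: x + ((b - a) * (herm x w / herm w w)) *: w) ->
  exists c w', [/\ c != 0, zvec w', primitive w' & w = c *: w'].
Proof.
move=> zA w0 ww ba AE.
set s := (b - a) / herm w w.
have s0 : s != 0 by rewrite mulf_neq0 ?invr_eq0 // subr_eq0.
have entry i (e : 'cV[C]_3) : (A *m e) i ord0 = a * e i ord0 + s * herm e w * w i ord0.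
  by rewrite AE !mxE /s; ring.
clearbody s.
have col_entry i j : A i j = (A *m \col_k (k == j)%:R) i ord0.
  by rewrite mxE (bigD1 j) //= mxE eqxx mulr1 big1 ?addr0 // => k kj; rewrite mxE (negPf kj) mulr0.
have E i j : A i j = a * (i == j)%:R + s * (w (rev_ord j) ord0)^* * w i ord0.
  rewrite col_entry entry // hermE !mxE; congr (_ + _ * _ * _).
  move: j; apply: forall_ord3; rewrite /= ?mul0r ?mul1r ?add0r ?addr0; congr (w _ _)^*; exact: val_inj.
have [y [y0 zy zya]] : exists y, [/\ y != 0, zi y & zi (y * a)].
  have [w1|w1] := eqVneq (w i1 ord0) 0.
    exists 1; split; rewrite ?oner_eq0 //; solve_zi.
    by have := zA i1 i1; rewrite E w1 mulr0 addr0 mulr1 mul1r.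
  have A00 : A i0 i0 = a + s * (w i2 ord0)^* * w i0 ord0.
    by rewrite E mulr1; congr (_ + _ * (w _ _)^* * _); exact: val_inj.
  have [w0'|w0'] := eqVneq (w i0 ord0) 0.
    exists 1; split; rewrite ?oner_eq0 //; solve_zi.
    by have := zA i0 i0; rewrite A00 w0' mulr0 addr0 mul1r.
  have A01 : A i0 i1 = s * (w i1 ord0)^* * w i0 ord0.
    by rewrite E mulr0 add0r; congr (_ * (w _ _)^* * _); exact: val_inj.
  have A20 : A i2 i0 = s * (w i2 ord0)^* * w i2 ord0.
    by rewrite E mulr0 add0r; congr (_ * (w _ _)^* * _); exact: val_inj.
  have A21 : A i2 i1 = s * (w i1 ord0)^* * w i2 ord0.
    by rewrite E mulr0 add0r; congr (_ * (w _ _)^* * _); exact: val_inj.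
  have [w2'|w2'] := eqVneq (w i2 ord0) 0.
    exists 1; split; rewrite ?oner_eq0 //; solve_zi.
    by have := zA i0 i0; rewrite A00 w2' rmorph0 mulr0 mul0r addr0 mul1r.
  exists (A i2 i1); split; first by rewrite A21 !mulf_eq0 conjC_eq0 !negb_or s0 w1 w2'.
    exact: zA.
  have -> : A i2 i1 * a = A i2 i1 * A i0 i0 - A i0 i1 * A i2 i0.
    by rewrite A21 A00 A01 A20; ring.
  by have := zA; solve_zi.
have [j wj] : exists j, w (rev_ord j) ord0 != 0.
  apply/not_existsP => h; move/eqP: w0; apply; apply/colP => i; rewrite mxE.
  by have := h (rev_ord i); rewrite rev_ordK => /negP/negPn/eqP ->.
pose c0 := y * s * (w (rev_ord j) ord0)^*.
have c00 : c0 != 0 by rewrite !mulf_eq0 conjC_eq0 !negb_or y0 s0 wj.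
have zc : zvec (c0 *: w).
  move=> i k; rewrite mxE ord1.
  have -> : c0 * w i 0 = y * A i j - y * a * (i == j)%:R by rewrite E /c0; ring.
  by have := zA i j; solve_zi.
have cw0 : c0 *: w != 0 by rewrite scaler_eq0 negb_or c00.
have [g [w' [zg g0 zw' pw' wE]]] := primitive_multiple hd zc cw0.
exists (c0^-1 * g), w'; split=> //.
  by rewrite mulf_neq0 ?invr_eq0.
by rewrite -scalerA -wE scalerA mulVf // scale1r.
Qed.

(* [2 / <w, w>] is an integer because the reflection preserves the lattice and
   [w] is primitive. *)
Lemma fixer_primitive_norm A w a b : zvec A -> zvec w -> primitive w -> 0 < herm w w ->
  a * a^* = 1 -> b * b^* = 1 -> b != a ->
  (forall x, A *m x = a *: x + ((b - a) * (herm x w / herm w w)) *: w) ->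
  herm w w = 1 \/ herm w w = 2.
Proof.
move=> zA zw pw ww aa bb ba AE; have ww0 : herm w w != 0 by rewrite gt_eqF.
have [ha hb] := fixer_integral_eigenvalues zA zw pw ww0 aa bb AE.
have [x zx xw] := pw.
have za : zi a by case: ha => ->; solve_zi.
have h2 : zi (2 / herm w w).
  have za2 : zi ((b - a) / herm w w).
    apply: (@primitive_coef (A *m x - a *: x) w) => //.
      by apply: zvecD (zvecM hd zA zx) (zvecN (zvecZ hd za zx)).
    by rewrite AE xw mul1r addrC addKr.
  case: ha hb ba za2 => -> [] ->; rewrite ?eqxx //.
    have -> : -1 - 1 = - 2 :> C by ring.
    by rewrite mulNr => _ h; rewrite -[2 / _]opprK; apply: ziN.
  by have -> : 1 - -1 = 2 :> C by ring.
have [m hm] : exists m : int, 2 / herm w w = m%:~R.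
  by apply: (zi_real hd h2); rewrite fmorph_div rmorph_nat /= herm_real.
have [k hk] := zi_real hd (zi_herm hd zw zw) (herm_real w).
have mk : m * k = 2.
  by apply: (@intr_inj C); rewrite rmorphM /= -hm -hk divfK.
have k0 : 0 < k by move: ww; rewrite hk ltr0z.
have m0 : 0 < m by nia.
have k2 : k <= 2 by nia.
rewrite hk; have [->|->] : k = 1 \/ k = 2 by lia.
  by left.
by right.
Qed.

Lemma perp_neg_exists w : 0 < herm w w -> exists2 n, herm n n < 0 & herm n w = 0.
Proof.
move=> ww; have [n1 _ _] := neg_basis_neg R.
by exists (perp_proj w (col3 1 0 (-1))); [exact: perp_proj_neg | exact: perp_proj_perp].
Qed.

Lemma mulmx_ext A B : (forall x, A *m x = B *m x) -> A = B.
Proof.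
move=> h; apply/matrixP => i j; have /colP/(_ i) := h (col j 1%:M).
rewrite !mxE (bigD1 j) //= [X in _ + X]big1 => [|k kj]; last by rewrite !mxE (negPf kj) mulr0.
rewrite (bigD1 j) //= [X in _ = _ + X]big1 => [|k kj]; last by rewrite !mxE (negPf kj) mulr0.
by rewrite !mxE eqxx !mulr1 !addr0.
Qed.

Lemma unitaryJ_isometry A : (forall x y, herm (A *m x) (A *m y) = herm x y) -> unitaryJ A.
Proof.
move=> h; apply/unitaryJP/matrixP => i j.
have colA k : col k A = A *m col k 1%:M.
  by apply/colP => l; rewrite -{1}[A]mulmx1 !mxE; apply: eq_bigr => t _; rewrite !mxE.
by rewrite gramE !colA h -gramE ctrmx1 mul1mx mulmx1.
Qed.

Definition reflmx w : 'M[C]_3 := 1%:M - (2 / herm w w) *: (w *m (ctrmx w *m J R)).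

Lemma reflmxE w x : reflmx w *m x = x - (2 * herm x w / herm w w) *: w.
Proof.
rewrite mulmxBl mul1mx -scalemxAl -!mulmxA (mulmxA (ctrmx w)).
by rewrite herm_rowE mul_mx_scalar scalerA mulrAC.
Qed.

Lemma reflmx_unitary w : 0 < herm w w -> unitaryJ (reflmx w).
Proof.
move=> ww; have ww0 : herm w w != 0 by rewrite gt_eqF.
apply: unitaryJ_isometry => x y; rewrite !reflmxE !herm_lin fmorph_div rmorphM rmorph_nat /= herm_real.
by rewrite -(herm_conj y w); field.
Qed.

Lemma reflmx_integral w : zvec w -> herm w w = 1 \/ herm w w = 2 -> zvec (reflmx w).
Proof.
move=> zw ww i j.
have z2 : zi (2 / herm w w).
  by case: ww => ->; rewrite ?divr1 ?divff ?pnatr_eq0 //; solve_zi.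
have zww : zvec (w *m (ctrmx w *m J R)).
  move=> k l; rewrite mxE big_ord1; apply: ziM => //.
  apply: zvecM => //; last exact: zvec_J.
  by move=> s t; rewrite !mxE; apply: zi_conj.
have := zww i j; rewrite /reflmx; move: (w *m _) => B zB.
by rewrite !mxE; solve_zi.
Qed.

Lemma reflmx_mirror w n : herm n w = 0 -> reflmx w *m n = n.
Proof. by move=> nw; rewrite reflmxE nw mulr0 mul0r scale0r subr0. Qed.

Lemma reflmx_pole w : herm w w != 0 -> reflmx w *m w = - w.
Proof. by move=> ww; rewrite reflmxE mulfK // scalerDl scale1r opprD addrA subrr sub0r. Qed.

Lemma reflmx_involutive w : herm w w != 0 -> reflmx w *m reflmx w = 1%:M.
Proof.
move=> ww; apply: mulmx_ext => x; rewrite -mulmxA mul1mx (reflmxE w x) mulmxBr -scalemxAr.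
by rewrite reflmx_pole // reflmxE scalerN opprK subrK.
Qed.

Lemma cyclic_of_order2 (G : groupType) (g : G) : g <> 1%g -> (g * g)%g = 1%g ->
  cyclic_of_order 2 [set 1%g; g].
Proof.
move=> g1 gg; have gV : (g^-1)%g = g by apply: mulg1_eq.
have gX k : (g ^+ k)%g = 1%g \/ (g ^+ k)%g = g.
  elim: k => [|k [IH|IH]]; first by left.
  - by right; rewrite expgS IH mulg1.
  - by left; rewrite expgS IH gg.
split.
  exists g; apply/seteqP; split=> x.
    by case=> ->; left; [exists 0%N | exists 1%N].
  case=> -[k _ <-]; first by case: (gX k) => ->; [left | right].
  by case: (gX k) => ->; [left; rewrite /= invg1 | right].
apply/eq_cardSP; exists g; first by right.
have -> : [set 1%g; g] `\ g = [set 1%g].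
  by apply/seteqP; split=> x /= => [[[-> //|->]] []// | ->]; split; [left | move/esym].
exact: card_set1.
Qed.

Lemma gamma_fixer_form (A : UJ R) w : zvec (UJval A) -> 0 < herm w w ->
  fixes_pointwise (\pi_(PU R) A) (mirror w) ->
  exists a b, [/\ a * a^* = 1, b * b^* = 1 &
    forall x, UJval A *m x = a *: x + ((b - a) * (herm x w / herm w w)) *: w].
Proof.
move=> zA ww fA; apply: mirror_fixer_form => //; first exact: UJvalP.
by move=> n nn nw; apply: act_fix_eigen; apply: fA; exact: mirror_line.
Qed.

Lemma PU_pi_scalar (A : UJ R) a : (forall x, UJval A *m x = a *: x) -> \pi_(PU R) A = 1%g.
Proof.
move=> h; apply/eqP/PU_eqP; exists a; apply: mulmx_ext => x.
by rewrite h -scalemxAl mul1mx.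
Qed.

(** With eigenvalues 1 or -1 there are, up to scalars, only the identity ([b = a]) and [reflmx w]
    ([b = - a]), the latter integral because the norm of [w] divides 2. *)
Lemma pointwise_fixer_cyclic w : zvec w -> primitive w -> herm w w = 1 \/ herm w w = 2 ->
  cyclic_of_order 2 (pointwise_fixer d (mirror w)).
Proof.
move=> zw pw w12.
have ww : 0 < herm w w by case: w12 => ->; [exact: ltr01 | rewrite ltr0n].
have ww0 : herm w w != 0 by rewrite gt_eqF.
pose Rw : UJ R := MkUJ (reflmx_unitary ww).
have -> : pointwise_fixer d (mirror w) = [set 1%g; \pi_(PU R) Rw].
  apply/seteqP; split=> h.
    case=> /GammaP[A [zA ->]] fA.
    have [a [b [aa bb AE]]] := gamma_fixer_form zA ww fA.
    have [ha hb] := fixer_integral_eigenvalues zA zw pw ww0 aa bb AE.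
    have [ba|ba] := eqVneq b a.
      by left; apply: (@PU_pi_scalar A a) => x; rewrite AE ba subrr mul0r scale0r addr0.
    right; apply/eqP/PU_eqP; exists a; apply: mulmx_ext => x.
    have bE : b = - a by case: ha hb ba => -> [] ->; rewrite ?eqxx ?opprK.
    rewrite AE bE -scalemxAl reflmxE scalerBr scalerA -scaleNr; congr (_ + _ *: _); ring.
  case=> ->; split.
  - by apply/GammaP; exists 1%g; split=> // i j; rewrite mxE; solve_zi.
  - by move=> L /mirrorP[v [vv vw ->]]; rewrite act_pi mul1mx.
  - by apply/GammaP; exists Rw; split=> //; exact: reflmx_integral.
  - by move=> L /mirrorP[v [vv vw ->]]; rewrite act_pi reflmx_mirror.
apply: cyclic_of_order2.
  move/eqP/PU_eqP => [c Rc].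
  have Rx x : reflmx w *m x = c *: x by rewrite [reflmx w]Rc -scalemxAl mul1mx.
  have [n nn nw] := perp_neg_exists ww.
  have c1 : c = 1.
    have n0 : herm n n != 0 by rewrite lt_eqF.
    by apply: (mulIf n0); rewrite mul1r -hermZl -Rx reflmx_mirror.
  have : herm (reflmx w *m w) w = herm w w by rewrite Rx c1 scale1r.
  rewrite reflmx_pole // hermNl => /eqP; rewrite eq_sym -addr_eq0 -mulr2n mulrn_eq0 /=.
  exact/negP.
rewrite -[LHS]/(PU_mul _ _) PU_piM; apply: (@PU_pi_scalar _ 1) => x.
by rewrite /= reflmx_involutive // mul1mx scale1r.
Qed.

(** A common mirror would make the two polar vectors proportional by an integral factor [c] with
    [1 = 2 * (c * c^* )]. *)
Lemma w_orbits_disjoint (A B : UJ R) : zvec (UJval A) -> zvec (UJval B) ->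
  act (\pi_(PU R) A) @` mirror (w1 R) = act (\pi_(PU R) B) @` mirror (w2 R) -> False.
Proof.
move=> zA zB; rewrite !act_mirror => E; have uA := UJvalP A; have uB := UJvalP B.
have z1 : zvec (UJval A *m w1 R) by exact: zvecM zA (zvec_w1 _ _).
have z2 : zvec (UJval B *m w2 R) by exact: zvecM zB (zvec_w2 _ _).
have n1 : herm (UJval A *m w1 R) (UJval A *m w1 R) = 1.
  by rewrite (herm_unitary _ _ uA) herm_w1.
have n2 : herm (UJval B *m w2 R) (UJval B *m w2 R) = 2.
  by rewrite (herm_unitary _ _ uB) herm_w2.
have [||c cE] := mirror_inj _ _ (esym E).
- by rewrite n2 ltr0n.
- by rewrite n1 ltr01.
apply: (@zi_norm_half R d hd c).
  exact: (primitive_coef z1 (primitive_image uB zB (primitive_w2 R d)) cE).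
by apply: etrans n1; rewrite cE hermZl hermZr n2; ring.
Qed.

Lemma reflection_mirror_orbit (g : PU R) (M : set {vspace 'cV[C]_3}) :
  Gamma d g -> g <> 1%g -> mirror_of g M ->
  in_Gamma_orbit d (mirror (w1 R)) M \/ in_Gamma_orbit d (mirror (w2 R)) M.
Proof.
move=> /GammaP[A [zA ->]] g1 [[w ww ->] fA].
have [a [b [aa bb AE]]] := gamma_fixer_form zA ww fA.
have ww0 : herm w w != 0 by rewrite gt_eqF.
have ba : b != a.
  apply/eqP => ba; apply: g1; apply: (@PU_pi_scalar A a) => x.
  by rewrite AE ba subrr mul0r scale0r addr0.
have w0 : w != 0.
  by apply: contraNneq ww0 => ->; rewrite -(scale0r 0) hermZl mul0r.
have [c [w' [c0 zw' pw' wE]]] := fixer_integral_polar zA w0 ww0 ba AE.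
rewrite wE (mirror_scale _ c0).
have cc : 0 < c * c^* by rewrite mul_conjC_gt0.
have wwE : herm w w = c * c^* * herm w' w' by rewrite wE hermZl hermZr; ring.
have ww' : 0 < herm w' w' by move: ww; rewrite wwE pmulr_rgt0.
have c0' : c^* != 0 by rewrite conjC_eq0.
have ww'0 : herm w' w' != 0 by rewrite gt_eqF.
have AE' x : UJval A *m x = a *: x + ((b - a) * (herm x w' / herm w' w')) *: w'.
  rewrite AE wwE {2}wE scalerA [in herm x w]wE hermZr; congr (_ + _ *: _).
  by field; rewrite c0 c0' ww'0.
have [n1|n2] := fixer_primitive_norm zA zw' pw' ww' aa bb ba AE'.
  have [B [uB zB Bw]] := norm1_orbit hd zw' n1.
  left; exists (\pi_(PU R) (MkUJ uB)); last by rewrite act_mirror /= Bw.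
  by apply/GammaP; exists (MkUJ uB).
have [B [uB zB Bw]] := norm2_orbit hd zw' pw' n2.
right; exists (\pi_(PU R) (MkUJ uB)); last by rewrite act_mirror /= Bw.
by apply/GammaP; exists (MkUJ uB).
Qed.

End Reflections.

Local Close Scope ring_scope.

Theorem mainTheorem11 (R : realType) (d : nat) (hd : d \in [:: 7; 11; 19]) :
  (forall (g : PU R) (M : set {vspace 'cV[R[i]]_3}),
     Gamma d g -> complex_reflection g -> mirror_of g M ->
     exists! w : 'cV[R[i]]_3,
       (w = w1 R \/ w = w2 R) /\ in_Gamma_orbit d (mirror w) M) /\
  (forall w : 'cV[R[i]]_3, w = w1 R \/ w = w2 R ->
     cyclic_of_order 2 (pointwise_fixer d (mirror w))).
Proof.
split; last first.
  move=> w [->|->]; apply: pointwise_fixer_cyclic => //.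
  - exact: zvec_w1.
  - exact: primitive_w1.
  - by left; exact: herm_w1.
  - exact: zvec_w2.
  - exact: primitive_w2.
  - by right; exact: herm_w2.
move=> g M gG [g1 _ _] gM.
have disj : in_Gamma_orbit d (mirror (w1 R)) M -> in_Gamma_orbit d (mirror (w2 R)) M -> False.
  move=> [_ /(GammaP hd)[A [zA ->]] ->] [_ /(GammaP hd)[B [zB ->]]].
  exact: (w_orbits_disjoint hd zA zB).
case: (reflection_mirror_orbit hd gG g1 gM) => orb.
  exists (w1 R); split; first by split=> //; left.
  by move=> w [[-> //|->] orb']; case: (disj orb orb').
exists (w2 R); split; first by split=> //; right.
by move=> w [[->|-> //] orb']; case: (disj orb' orb).
Qed.
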